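(* Let $a\in\mathbb{R}$. Then there exists $\psi\in C^\infty([0,1];\mathbb{R})$ with $\psi(0)=0$ and $\psi(1)=a$ such that $u=\Upsilon(\psi)$ belongs to $C^\infty(\overline{B^4(0,1)};S^4)$ and is a biharmonic map.
   Context: $B^4(0,1)\subset\mathbb{R}^4$ is the open unit ball and $S^4=\{y\in\mathbb{R}^5: |y|=1\}$. For $\psi:[0,1]\to\mathbb{R}$ with $\psi(0)=0$, the map $\Upsilon(\psi):\overline{B^4(0,1)}\to S^4$ is defined by $\Upsilon(\psi)(x)=\left(\frac{x}{|x|}\sin\psi(|x|),\cos\psi(|x|)\right)$ for $x\neq0$ and $\Upsilon(\psi)(0)=\hat e_5=(0,0,0,0,1)$. A (extrinsic) biharmonic map $u$ into $S^4$ is a critical point of $E_2(u)=\int_{B^4(0,1)}|\Delta u|^2\,dx$ among $S^4$-valued maps with the same boundary values $D^\alpha u$, $|\alpha|\le 1$; for a smooth map $u$ this means $\Delta^2u(x)\perp T_{u(x)}S^4$ for all $x\in B^4(0,1)$, with $\Delta$ the componentwise Laplacian of the $\mathbb{R}^5$-valued map $u$. *)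

(* Defs.v *)
From HB Require Import structures.
From mathcomp Require Import all_boot all_order all_algebra.
From mathcomp Require Import all_classical all_reals all_analysis.

Set Implicit Arguments.
Unset Strict Implicit.
Unset Printing Implicit Defensive.

Import Order.TTheory GRing.Theory Num.Theory.
Import numFieldNormedType.Exports.

Local Open Scope classical_set_scope.
Local Open Scope ring_scope.

(* The library norm `|x| on 'rV[R]_n is the sup norm; it induces the Euclidean
   topology, but balls and spheres have to be cut out by the Euclidean norm. *)
Definition dotv (R : realType) (n : nat) (x y : 'rV[R]_n) : R :=
  \sum_(i < n) x 0 i * y 0 i.

Definition enorm (R : realType) (n : nat) (x : 'rV[R]_n) : R :=
  Num.sqrt (dotv x x).

Definition open_ball1 (R : realType) (n : nat) : set 'rV[R]_n :=
  [set x | enorm x < 1].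

Definition closed_ball1 (R : realType) (n : nat) : set 'rV[R]_n :=
  [set x | enorm x <= 1].

Definition sphere1 (R : realType) (n : nat) : set 'rV[R]_n :=
  [set y | enorm y = 1].

(* C^oo([0,1]; R): psi is continuous on [0,1], and its derivatives of every
   order exist on ]0,1[ and extend continuously to [0,1].  Only the values of
   psi on [0,1] matter. *)
Definition smooth_unit_interval (R : realType) (psi : R -> R) : Prop :=
  {within `[0, 1], continuous psi} /\
  forall k : nat,
    (forall t : R, 0 < t < 1 -> derivable (derive1n k psi) t 1) /\
    (exists g : R -> R, {within `[0, 1], continuous g} /\
       forall t : R, 0 < t < 1 -> g t = derive1n k psi t).

Definition partial (R : realType) (n m : nat) (i : 'I_n)
    (f : 'rV[R]_n -> 'rV[R]_m) : 'rV[R]_n -> 'rV[R]_m :=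
  fun x => 'D_(delta_mx 0 i) f x.

(* A multi-index is given by the list of the variables to differentiate in. *)
Definition partials (R : realType) (n m : nat) (s : seq 'I_n)
    (f : 'rV[R]_n -> 'rV[R]_m) : 'rV[R]_n -> 'rV[R]_m :=
  foldr (fun i g => partial i g) f s.

(* C^oo of the closed unit ball: u is continuous on the closed ball, and its
   partial derivatives of every order exist on the open ball and extend
   continuously to the closed ball. *)
Definition smooth_closed_ball (R : realType) (n m : nat)
    (u : 'rV[R]_n -> 'rV[R]_m) : Prop :=
  {within @closed_ball1 R n, continuous u} /\
  forall s : seq 'I_n,
    (forall x, open_ball1 x ->
       forall i : 'I_n, derivable (partials s u) x (delta_mx 0 i)) /\
    (exists g : 'rV[R]_n -> 'rV[R]_m,
       {within @closed_ball1 R n, continuous g} /\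
       forall x, open_ball1 x -> g x = partials s u x).

Definition laplacian (R : realType) (n m : nat)
    (f : 'rV[R]_n -> 'rV[R]_m) : 'rV[R]_n -> 'rV[R]_m :=
  fun x => \sum_(i < n) partial i (partial i f) x.

Definition tangent_sphere (R : realType) (n : nat) (y : 'rV[R]_n) :
    set 'rV[R]_n :=
  [set v | dotv v y = 0].

(* The Euler-Lagrange equation of \int |laplacian u|^2 under the constraint
   |u| = 1, for a smooth map u. *)
Definition biharmonic_to_sphere (R : realType) (n m : nat)
    (u : 'rV[R]_n -> 'rV[R]_m) : Prop :=
  forall x, open_ball1 x ->
    forall v, tangent_sphere (u x) v -> dotv (laplacian (laplacian u) x) v = 0.

Definition Upsilon (R : realType) (psi : R -> R) (x : 'rV[R]_4) : 'rV[R]_5 :=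
  if x == 0 then delta_mx 0 ord_max
  else row_mx (sin (psi (enorm x)) *: ((enorm x)^-1 *: x))
              (const_mx (cos (psi (enorm x))) : 'rV[R]_1).

(* Main.v *)
Require Import Defs.
From mathcomp Require Import all_boot all_order all_algebra.
From mathcomp Require Import all_classical all_reals all_analysis.
From mathcomp Require Import ring lra.

(* In t = log r the equation for psi is autonomous, with first integral
   psi' psi''' - psi''^2/2 - 3/2 psi'^4 - (5 - 3 sin^2 psi) psi'^2 + 9/2 sin^2 psi.
   On its zero level, v = psi', p = psi''/psi', w = sin psi/psi', C = cos psi and
   S = sin psi satisfy a quadratic first order system.  A smooth map of the ball is
   a trajectory leaving the rest point v = 0, p = 3, w = 1/3, C = 1, S = 0 as
   t -> -oo.  It is analytic in r^3 near r = 0, and a parity argument makes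
   sin psi/r and cos psi analytic in r^2.  The inequalities p > 2, |w| < 3/5,
   p < v + 4 persist along the flow: the first one makes psi unbounded, and the
   last one bounds v by an exponential of psi, so that the trajectory continues
   until psi reaches any prescribed a > 0.  Rescaling r moves that point to r = 1,
   and a < 0 follows by changing the sign of psi. *)

Set Implicit Arguments.
Unset Strict Implicit.
Unset Printing Implicit Defensive.

Import Order.TTheory GRing.Theory Num.Theory.
Import numFieldNormedType.Exports.

Local Open Scope classical_set_scope.
Local Open Scope ring_scope.

(** * Finite smoothness along given directions *)

(** The energy is invariant under dilations of the 4-ball, which makes the equation autonomous in t;
    multiplied by psi', it becomes the derivative of the first integral. That integral is 0 for a
    trajectory issuing from the rest point, and solving its zero level for psi''' lowers the order
    by one at the price of dividing by psi'. Since psi' vanishes at the centre of the ball, the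
    quotients p and w are unknowns of their own, tied to psi by relations that the flow conserves.
    The linear equation at psi = 0 has the exponents 1, -1, 3, -3 in r. The branch r^3 is chosen
    because it starts inside the trap p > 2, whereas psi of order r would start at p = 1. Having
    only quadratic terms matters: a single power series argument then gives both the local solutions
    of the flow, with a lifetime controlled by the size of the data alone, and the solution issuing
    from the singular point r = 0. *)

Section Smooth.
Variables (R : realType) (V : normedModType R) (I : Type) (e : I -> V).
Implicit Types (U : set V) (f g : V -> R) (n : nat).

(** Continuity is demanded at every order because directional derivatives alone do not give it. The
    family [e] is [dir1] on the line and the coordinate directions in dimension 4, so that one
    calculus serves both. *)
Fixpoint Ck n U f : Prop :=
  (forall x, U x -> {for x, continuous f}) /\
  if n is m.+1 then
    forall i, (forall x, U x -> derivable f x (e i)) /\ Ck m U ('D_(e i) f)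
  else True.

Arguments Ck : simpl never.

Lemma Ck_continuous n U f x : Ck n U f -> U x -> {for x, continuous f}.
Proof. by case: n => [|n] [H _]; exact: H. Qed.

Lemma CkS n U f : Ck n.+1 U f -> Ck n U f.
Proof.
elim: n f => [|n IH] f; first by case.
case=> fc fd; split => // i; have [fi Di] := fd i.
by split => //; exact: IH.
Qed.

Lemma near_eq_on U f g : open U -> (forall x, U x -> f x = g x) ->
  forall x, U x -> {near x, f =1 g}.
Proof.
move=> oU fg x Ux.
have : nbhs x U by exact: open_nbhs_nbhs.
by apply: filterS => y; exact: fg.
Qed.

Lemma continuous_eq_on U f g : open U -> (forall x, U x -> f x = g x) ->
  (forall x, U x -> {for x, continuous f}) ->
  forall x, U x -> {for x, continuous g}.
Proof.
move=> oU fg fc x Ux; have nfg := near_eq_on oU fg Ux.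
suff : g y @[y --> x] --> f x by rewrite fg.
apply: cvg_trans (fc _ Ux); apply: near_eq_cvg.
by move: nfg; apply: filterS => y ->.
Qed.

Lemma Ck_eq n U f g : open U -> (forall x, U x -> f x = g x) ->
  Ck n U f -> Ck n U g.
Proof.
move=> oU; elim: n f g => [|n IH] f g fg [fc fd]; split => //.
- exact: continuous_eq_on oU fg fc.
- exact: continuous_eq_on oU fg fc.
move=> i; have [fi Di] := fd i; split => [x Ux|].
  by apply: near_eq_derivable (fi _ Ux); exact: near_eq_on oU fg x Ux.
apply: IH Di => x Ux; apply: near_eq_derive; exact: near_eq_on oU fg x Ux.
Qed.

Lemma CkU n U U' f : Ck n U f -> Ck n U' f -> Ck n (U `|` U') f.
Proof.
elim: n f => [|n IH] f [fc fd] [fc' fd']; split => //.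
- by move=> x [] Ux; [exact: fc|exact: fc'].
- by move=> x [] Ux; [exact: fc|exact: fc'].
move=> i; have [fi Di] := fd i; have [fi' Di'] := fd' i; split => [x|].
  by case=> Ux; [exact: fi|exact: fi'].
exact: IH.
Qed.

Lemma Ck_sub n U U' f : U' `<=` U -> Ck n U f -> Ck n U' f.
Proof.
move=> sU; elim: n f => [|n IH] f [fc fd]; split => //.
- by move=> x /sU/fc.
- by move=> x /sU/fc.
move=> i; have [fi Di] := fd i; split => [x /sU/fi//|]; exact: IH.
Qed.

Lemma Ck_cst n U (a : R) : Ck n U (cst a).
Proof.
elim: n a => [|n IH] a; split => //; try by move=> x _; exact: cst_continuous.
move=> i; split => [x _|]; first exact: derivable_cst.
have -> : 'D_(e i) (cst a) = cst 0 :> (V -> R) by apply/funext => x; rewrite derive_cst.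
exact: IH.
Qed.

Lemma CkD n U f g : open U -> Ck n U f -> Ck n U g -> Ck n U (f + g).
Proof.
move=> oU; elim: n f g => [|n IH] f g [fc fd] [gc gd]; split => //.
- by move=> x Ux; apply: continuousD; [exact: fc|exact: gc].
- by move=> x Ux; apply: continuousD; [exact: fc|exact: gc].
move=> i; have [fi Df] := fd i; have [gi Dg] := gd i; split => [x Ux|].
  by apply: derivableD; [exact: fi|exact: gi].
apply: (Ck_eq (f := 'D_(e i) f + 'D_(e i) g)) => // [x Ux|]; last exact: IH.
by rewrite deriveD//; [exact: fi|exact: gi].
Qed.

Lemma CkM n U f g : open U -> Ck n U f -> Ck n U g -> Ck n U (f * g).
Proof.
move=> oU; elim: n f g => [|n IH] f g hf hg.
  case: hf => fc _; case: hg => gc _; split => // x Ux.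
  by apply: continuousM; [exact: fc|exact: gc].
have hf0 := CkS hf; have hg0 := CkS hg.
case: hf => fc fd; case: hg => gc gd; split.
  by move=> x Ux; apply: continuousM; [exact: fc|exact: gc].
move=> i; have [fi Df] := fd i; have [gi Dg] := gd i; split => [x Ux|].
  by apply: derivableM; [exact: fi|exact: gi].
apply: (Ck_eq (f := f * 'D_(e i) g + g * 'D_(e i) f)) => // [x Ux|].
  by rewrite deriveM//; [exact: fi|exact: gi].
by apply: CkD => //; exact: IH.
Qed.

Lemma CkZ n U (a : R) f : open U -> Ck n U f -> Ck n U (fun x => a * f x).
Proof. by move=> oU hf; apply: (CkM (f := cst a)) => //; exact: Ck_cst. Qed.

Lemma CkN n U f : open U -> Ck n U f -> Ck n U (- f).
Proof.
move=> oU hf; have -> : - f = (fun x => - 1 * f x) by apply/funext => x; rewrite mulN1r.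
exact: CkZ.
Qed.

Lemma Ck_sum (J : Type) (r : seq J) n U (F : J -> V -> R) : open U ->
  (forall j, Ck n U (F j)) -> Ck n U (fun x => \sum_(j <- r) F j x).
Proof.
move=> oU HF; elim: r => [|j r IH].
  have -> : (fun x => \sum_(j <- [::]) F j x) = cst 0 by apply/funext => x; rewrite big_nil.
  exact: Ck_cst.
have -> : (fun x => \sum_(j <- j :: r) F j x) = F j + (fun x => \sum_(j <- r) F j x).
  by apply/funext => x; rewrite big_cons.
exact: CkD.
Qed.

Lemma CkX n U f k : open U -> Ck n U f -> Ck n U (fun x => f x ^+ k).
Proof.
move=> oU hf; elim: k => [|k IH].
  have -> : (fun x => f x ^+ 0) = cst 1 by apply/funext => x; rewrite expr0.
  exact: Ck_cst.
have -> : (fun x => f x ^+ k.+1) = f * (fun x => f x ^+ k).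
  by apply/funext => x; rewrite exprS.
exact: CkM.
Qed.

Lemma Ck_step n U f (g : I -> V -> R) : open U ->
  (forall x, U x -> {for x, continuous f}) ->
  (forall i x, U x -> is_derive x (e i) f (g i x)) ->
  (forall i, Ck n U (g i)) -> Ck n.+1 U f.
Proof.
move=> oU fc fg hg; split => // i; split.
  by move=> x Ux; have [] := fg i x Ux.
apply: Ck_eq (hg i) => // x Ux; by have [_ ->] := fg i x Ux.
Qed.

End Smooth.

(** * Smooth functions of one variable and composition with them *)

Section SmoothR.
Variable R : realType.

Definition dir1 (_ : unit) : R := 1.
Notation Ck1 := (Ck dir1).

Lemma is_derive_continuous (f : R -> R) (x a : R) : is_derive x 1 f a -> {for x, continuous f}.
Proof. by move=> [fx _]; exact/differentiable_continuous/derivable1_diffP. Qed.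

Lemma Ck1_step n (U : set R) (f g : R -> R) : open U ->
  (forall x, U x -> is_derive x (1 : R) f (g x)) -> Ck1 n U g -> Ck1 n.+1 U f.
Proof.
move=> oU fg hg; apply: (Ck_step (g := fun=> g)) => // x Ux.
exact: is_derive_continuous (fg x Ux).
Qed.

Lemma derive_line (V : normedModType R) (f : V -> R) (x v : V) :
  'D_1 (fun h : R => f (h *: v + x)) (0 : R) = 'D_v f x.
Proof.
rewrite /derive; set g1 := fun h => h^-1 *: _; set g2 := fun h => h^-1 *: _.
suff -> : g1 = g2 by [].
by rewrite funeqE /g1 /g2 => h /=; rewrite addr0 scale0r add0r [_%:A]mulr1.
Qed.

(** Restriction to the line through [x] with direction [v] reduces this to the chain rule in one
    variable, so that a directional derivative of [g] is enough. *)
Lemma is_derive_along (V : normedModType R) (f : R -> R) (g : V -> R) (x v : V) (a b : R) :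
  is_derive (g x) 1 f a -> is_derive x v g b -> is_derive x v (f \o g) (a * b).
Proof.
move=> fa [gd gb].
have H : is_derive (0 : R) 1 (fun h : R => g (h *: v + x)) b.
  by split; [exact: (derivable1P _ _ _).1 gd|rewrite derive_line].
have fa' : is_derive (g (0 *: v + x)) 1 f a by rewrite scale0r add0r.
have [cd cb] := @is_derive1_comp _ f (fun h : R => g (h *: v + x)) 0 a b fa' H.
split; first exact: (derivable1P _ _ _).2 cd.
by rewrite -cb -derive_line.
Qed.

Lemma Ck_comp (V : normedModType R) (I : Type) (e : I -> V) n (U : set V)
    (W : set R) (f : R -> R) (g : V -> R) :
  open U -> (forall x, U x -> W (g x)) ->
  Ck1 n W f -> Ck e n U g -> Ck e n U (f \o g).
Proof.
move=> oU gW; elim: n f g gW => [|n IH] f g gW hf hg.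
  split => // x Ux; apply: continuous_comp; first exact: Ck_continuous hg Ux.
  exact: Ck_continuous hf (gW _ Ux).
have hg0 := CkS hg.
split.
  move=> x Ux; apply: continuous_comp; first exact: Ck_continuous hg Ux.
  exact: Ck_continuous hf (gW _ Ux).
case: hf => fc /(_ tt) [fd hf1]; case: hg => gc gd i; have [gi hgi] := gd i.
have H x : U x -> is_derive x (e i) (f \o g) ('D_1 f (g x) * 'D_(e i) g x).
  by move=> Ux; apply: is_derive_along; [exact/derivableP/fd/gW|exact/derivableP/gi].
split => [x Ux|]; first by have [] := H x Ux.
apply: (Ck_eq (f := ('D_1 f \o g) * 'D_(e i) g)) => // [x Ux|].
  by have [_ ->] := H x Ux.
by apply: CkM => //; exact: IH.
Qed.

Lemma Ck1_id n (U : set R) : Ck1 n U id.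
Proof.
case: n => [|n]; split => //; try by move=> x _; exact: cvg_id.
move=> i; split => [x _|]; first exact: derivable_id.
have -> : 'D_(dir1 i) (id : R -> R) = cst 1 by apply/funext => x; rewrite derive_id.
exact: Ck_cst.
Qed.

Lemma Ck1_expR n (U : set R) : open U -> Ck1 n U expR.
Proof.
move=> oU; elim: n => [|n IH].
  by split => // x _; exact: continuous_expR.
exact: (Ck1_step (g := expR)).
Qed.

Lemma open_between (u w : R) : open [set x | u < x < w].
Proof.
rewrite (_ : mkset _ = [set x | u < x] `&` [set x | x < w]).
  by apply: openI; [exact: open_gt|exact: open_lt].
by apply/seteqP; split => x /= /andP.
Qed.

Lemma Ck1_derive1 n (U : set R) (f : R -> R) : Ck1 n.+1 U f -> Ck1 n U f^`()%classic.
Proof.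
case=> _ /(_ tt) [_]; congr (Ck _ _ _ _).
by apply/funext => x; rewrite derive1E.
Qed.

Definition Rpos : set R := [set x | 0 < x].

Lemma open_Rpos : open Rpos.
Proof. exact: open_gt. Qed.

Lemma Ck1_inv n : Ck1 n Rpos (fun x : R => x^-1).
Proof.
have H x : Rpos x -> is_derive x (1 : R) (fun y : R => y^-1) (- (x^-1 * x^-1)).
  move=> x0; apply: is_derive_eq.
    by apply: (@is_deriveV R id); rewrite /= gt_eqF.
  by rewrite /= /GRing.scale/= mulr1 expr2 invfM.
elim: n => [|n IH].
  by split => // x /H; exact: is_derive_continuous.
apply: Ck1_step H _; first exact: open_Rpos.
apply: CkN; first exact: open_Rpos.
apply: (CkM (f := fun x : R => x^-1) (g := fun x : R => x^-1)); [exact: open_Rpos|exact: IH|exact: IH].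
Qed.

Lemma Ck1_ln n : Ck1 n Rpos (@ln R).
Proof.
suff : Ck1 n.+1 Rpos (@ln R) by exact: CkS.
exact: (Ck1_step open_Rpos _ (Ck1_inv n)).
Qed.

End SmoothR.

(** * Power series *)

Section PowerSeries.
Variable R : realType.
Implicit Types (a b : nat -> R) (r x : R).

Definition psum a x : R := limn (pseries a x).
Definition pcvg r a := forall x, `|x| < r -> cvgn (pseries a x).
Definition cauchy_prod a b n : R := \sum_(i < n.+1) a i * b (n - i)%N.

(** [p ^+ n.+1 - q ^+ n.+1] is [p - q] times a sum of [n.+1] terms, each at least [q ^+ n]. A
    slightly larger ratio thus absorbs the factor [n.+1] produced by differentiation and by Cauchy
    products. *)
Lemma mulrn_geometric_le (q p : R) n : 0 <= q -> q < p ->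
  n.+1%:R * q ^+ n <= p ^+ n.+1 / (p - q).
Proof.
move=> q0 qp; rewrite ler_pdivlMr ?subr_gt0//.
apply: (@le_trans _ _ (p ^+ n.+1 - q ^+ n.+1)); last first.
  by rewrite gerBl exprn_ge0.
rewrite subrXX mulrC ler_wpM2l ?subr_ge0 ?(ltW qp)//.
rewrite -[leLHS]/(n.+1%:R * q ^+ n) mulr_natl.
rewrite -{1}[n.+1]card_ord -sumr_const ler_sum// => i _ /=.
rewrite -{1}[n](@subnK i) ?leq_ord// exprD ler_wpM2r ?exprn_ge0//.
rewrite /=; apply: lerXn2r; rewrite ?nnegrE//; [exact: le_trans (ltW qp)|exact: ltW].
Qed.

Lemma pcvg_geometric a M K : 0 < K -> (forall n, `|a n| <= M * K ^+ n) ->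
  pcvg K^-1 a.
Proof.
move=> K0 aM x xK; apply: normed_cvg.
have Kx : `|K * `|x| | < 1.
  by rewrite normrM normr_id gtr0_norm// mulrC -ltr_pdivlMr// div1r.
have M0 : 0 <= M by have := le_trans (normr_ge0 _) (aM 0%N); rewrite expr0 mulr1.
apply: (@series_le_cvg _ _ (geometric M (K * `|x|))) => [n|n|n|] /=.
- exact: normr_ge0.
- by rewrite mulr_ge0// exprn_ge0// mulr_ge0// ltW.
- by rewrite normrM normrX exprMn mulrA ler_wpM2r// exprn_ge0.
exact: is_cvg_geometric_series.
Qed.

(** The terms of the series are bounded at a point y with |x| < y < r, so at [x] they decay with
    ratio |x| / y. The part 1 / y of the constant pays for the index shift in [pseries_diffs]. *)
Lemma pcvg_bound r a x : pcvg r a -> `|x| < r ->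
  exists q M : R, [/\ 0 <= q, q < 1, 0 <= M &
    forall n, `|a n * x ^+ n| <= M * q ^+ n /\
      `|pseries_diffs a n * x ^+ n| <= M * n.+1%:R * q ^+ n].
Proof.
move=> ar xr; pose y := (`|x| + r) / 2.
have xy : `|x| < y by rewrite /y; lra.
have yr : y < r by rewrite /y; lra.
have y0 : 0 < y by apply: le_lt_trans xy.
have Cy : cvgn (pseries a y) by apply: ar; rewrite gtr0_norm.
have [K [Kreal Kf]] := cvg_series_bounded Cy.
pose M := `|K| + 1.
have aM n : `|a n * y ^+ n| <= M.
  by apply: Kf => //; rewrite /M (le_lt_trans (ler_norm _))// ltrDl.
have M0 : 0 <= M by rewrite /M addr_ge0.
have an n : `|a n| <= M / y ^+ n.
  rewrite ler_pdivlMr ?exprn_gt0//; apply: le_trans (aM n).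
  by rewrite normrM normrX (gtr0_norm y0).
exists (`|x| / y), (M * (1 + y^-1)); split.
- by rewrite divr_ge0// ltW.
- by rewrite ltr_pdivrMr// mul1r.
- by rewrite mulr_ge0// addr_ge0// invr_ge0 ltW.
move=> n; split.
  rewrite normrM normrX exprMn exprVn.
  apply: (@le_trans _ _ (M / y ^+ n * `|x| ^+ n)).
    by rewrite ler_wpM2r// exprn_ge0.
  have -> : M * (1 + y^-1) * (`|x| ^+ n / y ^+ n) =
      M / y ^+ n * `|x| ^+ n + M / y * (`|x| ^+ n / y ^+ n) by ring.
  have y0' := ltW y0.
  by rewrite lerDl !mulr_ge0 ?invr_ge0 ?exprn_ge0.
rewrite /pseries_diffs !normrM normrX normr_nat exprMn exprVn.
apply: (@le_trans _ _ (n.+1%:R * (M / y ^+ n.+1) * `|x| ^+ n)).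
  by rewrite ler_wpM2r ?exprn_ge0// ler_wpM2l.
have -> : n.+1%:R * (M / y ^+ n.+1) * `|x| ^+ n =
    M * y^-1 * n.+1%:R * (`|x| ^+ n / y ^+ n).
  by rewrite exprS invfM; ring.
rewrite ler_wpM2r ?mulr_ge0 ?invr_ge0 ?exprn_ge0// ?(ltW y0)//.
by rewrite ler_wpM2r// ler_wpM2l// lerDr.
Qed.

Lemma pcvg_diffs r a : pcvg r a -> pcvg r (pseries_diffs a).
Proof.
move=> ar x xr; have [q [M [q0 q1 M0 H]]] := pcvg_bound ar xr.
have [p qp p1] : exists2 p, q < p & p < 1 by exists ((q + 1) / 2); lra.
have p0 : 0 <= p by apply: le_trans (ltW qp).
apply: normed_cvg.
apply: (@series_le_cvg _ _ (geometric (M * (p / (p - q))) p)) => [n|n|n|] /=.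
- exact: normr_ge0.
- apply: mulr_ge0; last exact: exprn_ge0.
  by apply: mulr_ge0 => //; apply: divr_ge0 => //; rewrite subr_ge0 ltW.
- apply: le_trans (H n).2 _; rewrite -!mulrA ler_wpM2l//.
  apply: le_trans (mulrn_geometric_le n q0 qp) _.
  by rewrite exprS le_eqVlt; apply/orP; left; apply/eqP; ring.
by apply: is_cvg_geometric_series; rewrite ger0_norm.
Qed.

Lemma is_derive_psum r a x : pcvg r a -> `|x| < r ->
  is_derive x 1 (psum a) (psum (pseries_diffs a) x).
Proof.
move=> ar xr; pose y := (`|x| + r) / 2.
have xy : `|x| < y by rewrite /y; lra.
have yr : y < r by rewrite /y; lra.
have y0 : 0 < y by apply: le_lt_trans xy.
have yyr : `|y| < r by rewrite gtr0_norm.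
apply: (@pseries_snd_diffs _ _ y).
- exact: ar.
- exact: pcvg_diffs ar _ yyr.
- exact: pcvg_diffs (pcvg_diffs ar) _ yyr.
by rewrite (gtr0_norm y0).
Qed.

Lemma open_disc r : open [set x : R | `|x| < r].
Proof.
rewrite (_ : mkset _ = (Num.norm @^-1` [set y : R | y < r])); last by [].
by apply: open_comp => [x _|]; [exact: norm_continuous|exact: open_lt].
Qed.

Lemma Ck1_psum n r a : pcvg r a -> Ck (@dir1 R) n [set x | `|x| < r] (psum a).
Proof.
elim: n a => [|n IH] a ar.
  split => // x xr; have := is_derive_psum ar xr.
  exact: is_derive_continuous.
have H x : `|x| < r -> is_derive x 1 (psum a) (psum (pseries_diffs a) x).
  exact: is_derive_psum.
exact: (Ck1_step (@open_disc r) H (IH _ (pcvg_diffs ar))).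
Qed.

Lemma psum_eq a x l : pseries a x @ \oo --> l -> psum a x = l.
Proof. exact: cvg_lim. Qed.

Lemma cvgn_eq (u w : nat -> R) (l : R) : (forall n, u n = w n) ->
  w @ \oo --> l -> u @ \oo --> l.
Proof. by move=> /funext ->. Qed.

Lemma psum0 a : psum a 0 = a 0%N.
Proof.
apply: psum_eq; rewrite -(cvg_shiftn 1).
apply: (@cvg_trans _ ((fun=> a 0%N) @ \oo)); last exact: cvg_cst.
apply: near_eq_cvg; near=> n => /=.
rewrite /pseries /series/= addn1 big_nat_recl//= expr0 mulr1 big1 ?addr0// => i _.
by rewrite exprS mul0r mulr0.
Unshelve. all: by end_near. Qed.

Lemma psum_shift r a x : pcvg r a -> `|x| < r ->
  cvgn (pseries (fun n => a n.+1) x) /\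
  psum a x = a 0%N + x * psum (fun n => a n.+1) x.
Proof.
move=> ar xr; have [->|x0] := eqVneq x 0.
  rewrite mul0r addr0 psum0; split => //; apply/cvg_ex; exists (a 1%N).
  rewrite -(cvg_shiftn 1).
  apply: (@cvg_trans _ ((fun=> a 1%N) @ \oo)); last exact: cvg_cst.
  apply: near_eq_cvg; near=> n => /=.
  rewrite /pseries /series/= addn1 big_nat_recl//= expr0 mulr1 big1 ?addr0// => i _.
  by rewrite exprS mul0r mulr0.
have H : pseries (fun n => a n.+1) x @ \oo --> x^-1 * (psum a x - a 0%N).
  have : [sequence pseries a x n.+1]_n @ \oo --> psum a x.
    by rewrite cvg_shiftS; exact: ar.
  move=> H; apply: cvgn_eq (cvgMl_tmp (a := x^-1) (cvgB H (cvg_cst (a 0%N)))) => n.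
  rewrite /pseries /series /= !fctE/= big_nat_recl//= expr0 mulr1 addrC addKr.
  rewrite mulr_sumr; apply: eq_bigr => i _.
  by rewrite exprS [RHS]mulrCA mulKf.
split; first by apply/cvg_ex; eexists; exact: H.
by rewrite (psum_eq H) mulrA divff// mul1r addrC subrK.
Unshelve. all: by end_near. Qed.

Lemma psumD r a b x : pcvg r a -> pcvg r b -> `|x| < r ->
  cvgn (pseries (fun n => a n + b n) x) /\
  psum (fun n => a n + b n) x = psum a x + psum b x.
Proof.
move=> ar br xr.
have H : pseries (fun n => a n + b n) x @ \oo --> psum a x + psum b x.
  apply: cvgn_eq (cvgD (ar x xr) (br x xr)) => n.
  rewrite /pseries /series /= fctE/= -big_split/=; apply: eq_bigr => i _.
  by rewrite mulrDl.
by split; [apply/cvg_ex; eexists; exact: H|exact: psum_eq].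
Qed.

Lemma psumZ r (c : R) a x : pcvg r a -> `|x| < r ->
  cvgn (pseries (fun n => c * a n) x) /\
  psum (fun n => c * a n) x = c * psum a x.
Proof.
move=> ar xr.
have H : pseries (fun n => c * a n) x @ \oo --> c * psum a x.
  apply: cvgn_eq (cvgMl_tmp (a := c) (ar x xr)) => n.
  rewrite /pseries /series /= mulr_sumr; apply: eq_bigr => i _.
  by rewrite mulrA.
by split; [apply/cvg_ex; eexists; exact: H|exact: psum_eq].
Qed.

Lemma psum_sum (J : Type) (s : seq J) r (A : J -> nat -> R) x :
  (forall j, pcvg r (A j)) -> `|x| < r ->
  cvgn (pseries (fun n => \sum_(j <- s) A j n) x) /\
  psum (fun n => \sum_(j <- s) A j n) x = \sum_(j <- s) psum (A j) x.
Proof.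
move=> Ar xr; have H : pcvg r (fun n => \sum_(j <- s) A j n) /\
    forall y, `|y| < r -> psum (fun n => \sum_(j <- s) A j n) y = \sum_(j <- s) psum (A j) y.
  elim: s => [|j s [IH1 IH2]].
    have H y : pseries (fun n => \sum_(j <- [::]) A j n) y @ \oo --> (0 : R).
      apply: (@cvg_trans _ ((fun=> 0 : R) @ \oo)); last exact: cvg_cst.
      apply: near_eq_cvg; near=> n => /=.
      by rewrite /pseries /series/= big1// => i _; rewrite big_nil mul0r.
    split=> y yr; first by apply/cvg_ex; exists 0.
    by rewrite (psum_eq (H y)) big_nil.
  have E : (fun n => \sum_(j0 <- j :: s) A j0 n) =
           (fun n => A j n + (fun n => \sum_(j <- s) A j n) n).
    by apply/funext => n; rewrite big_cons.
  rewrite E; split => y yr; first exact: (psumD (Ar j) IH1 yr).1.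
  by rewrite (psumD (Ar j) IH1 yr).2 big_cons IH2.
by split; [exact: H.1|exact: H.2].
Unshelve. all: by end_near. Qed.

(* The product of two partial sums is the value at 1 of a product of polynomials,
   and its coefficients of index at least N form a tail of a convergent series. *)
Lemma psumM r a b x : pcvg r a -> pcvg r b -> `|x| < r ->
  cvgn (pseries (cauchy_prod a b) x) /\
  psum (cauchy_prod a b) x = psum a x * psum b x.
Proof.
move=> ar br xr.
have [q1 [M1 [q10 q11 M10 H1]]] := pcvg_bound ar xr.
have [q2 [M2 [q20 q21 M20 H2]]] := pcvg_bound br xr.
pose q := Num.max q1 q2.
have q0 : 0 <= q by rewrite le_max q10.
have qlt : q < 1 by rewrite gt_max q11.
pose u i := a i * x ^+ i; pose w i := b i * x ^+ i.
have uq i : `|u i| <= M1 * q ^+ i.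
  apply: le_trans (H1 i).1 _; rewrite ler_wpM2l// lerXn2r ?nnegrE//.
  by rewrite le_max lexx.
have wq i : `|w i| <= M2 * q ^+ i.
  apply: le_trans (H2 i).1 _; rewrite ler_wpM2l// lerXn2r ?nnegrE//.
  by rewrite le_max lexx orbT.
have [p qp p1] : exists2 p, q < p & p < 1 by exists ((q + 1) / 2); lra.
have p0 : 0 < p by apply: le_lt_trans qp.
pose C := M1 * M2 * (p / (p - q)).
have C0 : 0 <= C.
  by apply: mulr_ge0; [exact: mulr_ge0|apply: divr_ge0; rewrite ?subr_ge0 ltW].
have key N : `|pseries (cauchy_prod a b) x N - pseries a x N * pseries b x N| <=
    C * p ^+ N * (1 - p)^-1.
  pose f := \poly_(i < N) u i; pose g := \poly_(i < N) w i.
  have fE : pseries a x N = f.[1].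
    rewrite /pseries /series/= (horner_coef_wide _ (size_poly N u)) big_mkord.
    by apply: eq_bigr => i _; rewrite expr1n mulr1 coef_poly ltn_ord.
  have gE : pseries b x N = g.[1].
    rewrite /pseries /series/= (horner_coef_wide _ (size_poly N w)) big_mkord.
    by apply: eq_bigr => i _; rewrite expr1n mulr1 coef_poly ltn_ord.
  have sfg : (size (f * g)%R <= N + N)%N.
    apply: leq_trans (size_polyMleq _ _) _; apply: leq_trans (leq_pred _) _.
    by rewrite leq_add ?size_poly.
  rewrite fE gE -hornerM (horner_coef_wide _ sfg).
  have -> : \sum_(i < N + N) (f * g)`_i * 1 ^+ i =
      \sum_(0 <= i < N) (f * g)`_i + \sum_(N <= i < N + N) (f * g)`_i.
    rewrite -big_cat_nat ?leq_addr//= big_mkord.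
    by apply: eq_bigr => i _; rewrite expr1n mulr1.
  have -> : \sum_(0 <= i < N) (f * g)`_i = pseries (cauchy_prod a b) x N.
    rewrite /pseries /series/=; apply: eq_big_nat => n /andP[_ nN].
    rewrite coefM /cauchy_prod mulr_suml; apply: eq_bigr => i _.
    have iN : (i < N)%N by apply: leq_ltn_trans nN; rewrite leq_ord.
    rewrite !coef_poly iN (leq_ltn_trans (leq_subr _ _) nN) /u /w.
    have -> : x ^+ n = x ^+ i * x ^+ (n - i) by rewrite -exprD subnKC ?leq_ord.
    ring.
  rewrite opprD addrA subrr add0r normrN.
  apply: le_trans (ler_norm_sum _ _ _) _.
  apply: (@le_trans _ _ (\sum_(N <= i < N + N) C * p ^+ i)).
    apply: ler_sum => n _.
    apply: (@le_trans _ _ (M1 * M2 * (n.+1%:R * q ^+ n))); last first.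
      rewrite /C -!mulrA ler_wpM2l// ler_wpM2l//.
      apply: le_trans (mulrn_geometric_le n q0 qp) _.
      by rewrite exprS le_eqVlt; apply/orP; left; apply/eqP; ring.
    rewrite coefM; apply: le_trans (ler_norm_sum _ _ _) _.
    have -> : n.+1%:R * q ^+ n = \sum_(i < n.+1) q ^+ n.
      by rewrite sumr_const card_ord mulr_natl.
    rewrite mulr_sumr ler_sum// => i _.
    have -> : q ^+ n = q ^+ i * q ^+ (n - i) by rewrite -exprD subnKC ?leq_ord.
    rewrite normrM !coef_poly mulrACA.
    apply: ler_pM => //.
      by case: ifP => // _; rewrite normr0 mulr_ge0// exprn_ge0.
    by case: ifP => // _; rewrite normr0 mulr_ge0// exprn_ge0.
  rewrite -mulr_sumr geometric_partial_tail -mulrA ler_wpM2l//.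
  by apply: geometric_le_lim => //; rewrite ?exprn_ge0 ?(ltW p0)// gtr0_norm.
have H : pseries (cauchy_prod a b) x @ \oo --> psum a x * psum b x.
  apply: (@cvg_sub0 _ _ _ _ _ _ (fun N => pseries a x N * pseries b x N)).
    apply/cvgr0Pnorm_le => e e0.
    have : geometric (C * (1 - p)^-1) p @ \oo --> 0.
      by apply: cvg_geometric; rewrite gtr0_norm.
    move=> /cvgr0Pnorm_le/(_ e e0); apply: filterS => N /=.
    move=> HN; apply: le_trans (key N) _; apply: le_trans HN.
    by rewrite mulrAC ler_norm.
  exact: cvgM (ar x xr) (br x xr).
by split; [apply/cvg_ex; eexists; exact: H|exact: psum_eq].
Qed.

(** The partial sums in [x ^+ 2] are the partial sums in [x] of even index, hence a subsequence. *)
Lemma psum_even r a x : pcvg r a -> `|x| < r ->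
  (forall n, odd n -> a n = 0) ->
  pseries (fun m => a m.*2) (x ^+ 2) @ \oo --> psum a x.
Proof.
move=> ar xr aodd.
have -> : pseries (fun m => a m.*2) (x ^+ 2) = pseries a x \o double.
  apply/funext => N /=; rewrite /pseries /series/=.
  elim: N => [|N IH]; first by rewrite !big_nil.
  rewrite big_nat_recr//= IH doubleS !big_nat_recr//=.
  by rewrite (aodd N.*2.+1) ?mul0r ?addr0 -?exprM ?mul2n//= odd_double.
apply: cvg_comp (ar x xr) => A [N _ NA]; exists N => // n /= Nn; apply: NA => /=.
by rewrite -addnn (leq_trans Nn)// leq_addr.
Qed.

End PowerSeries.

(** * Quadratic differential systems *)

(* Power series solution [x] of [t x_i' + d_i (x_i - b_i) = t Q_i(x, x)]; the shift
   [d = 0] gives a regular system, [d > 0] a regular singular one. *)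
Section QuadraticSystem.
Variables (R : realType) (N : nat).
Variables (Q : 'I_N -> 'I_N -> 'I_N -> R) (d b : 'I_N -> R).

Definition quad (y z : 'I_N -> R) i : R := \sum_j \sum_k Q i j k * (y j * z k).

Definition conv_quad (x : nat -> 'I_N -> R) m i : R :=
  \sum_j \sum_k Q i j k * cauchy_prod (x^~ j) (x^~ k) m.

(* Only the values of [table m] at indices at most [m] are meaningful. *)
Fixpoint table (m : nat) : nat -> 'I_N -> R :=
  if m is m'.+1 then fun l => if (l <= m')%N then table m' l
    else fun i => conv_quad (table m') m' i / (m'.+1%:R + d i)
  else fun=> b.

Definition ode_coef m := table m m.

Lemma tableE m l : (l <= m)%N -> table m l = ode_coef l.
Proof.
elim: m => [|m IH]; first by rewrite leqn0 => /eqP ->.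
rewrite leq_eqVlt => /orP[/eqP -> //|lm] /=.
by rewrite -ltnS lm IH.
Qed.

Lemma ode_coef0 : ode_coef 0 = b. Proof. by []. Qed.

Hypothesis d0 : forall i, 0 <= d i.

Lemma ode_coefS m i : (m.+1%:R + d i) * ode_coef m.+1 i = conv_quad ode_coef m i.
Proof.
have m0 : m.+1%:R + d i != 0 by rewrite gt_eqF// ltr_wpDr// ltr0n.
rewrite /ode_coef /= ltnn mulrC divfK//.
apply: eq_bigr => j _; apply: eq_bigr => k _; congr (_ * _).
apply: eq_bigr => l _; rewrite !tableE ?leq_ord// leq_subr//.
Qed.

Variables q rho : R.
Hypotheses (q0 : 0 < q) (rho0 : 0 < rho).
Hypothesis Qq : forall i, \sum_j \sum_k `|Q i j k| <= q.
Hypothesis brho : forall i, `|b i| <= rho.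

(** By induction each of the m + 1 terms of a Cauchy product is at most rho^2 (q rho)^m. The divisor
    [m.+1%:R + d i] is at least m + 1 and cancels their number, so the bound stays exactly
    geometric. *)
Lemma ode_coef_bound m i : `|ode_coef m i| <= rho * (q * rho) ^+ m.
Proof.
elim/ltn_ind: m i => -[|m] IH i; first by rewrite expr0 mulr1 ode_coef0.
have m0 : 0 < m.+1%:R + d i by rewrite ltr_wpDr// ltr0n.
rewrite -(ler_pM2l m0) -{1}[m.+1%:R + d i]gtr0_norm// -normrM ode_coefS.
apply: (@le_trans _ _ (m.+1%:R * (rho * (q * rho) ^+ m.+1))); last first.
  by rewrite ler_wpM2r ?lerDl// mulr_ge0 ?exprn_ge0 ?mulr_ge0 ?(ltW q0) ?(ltW rho0).
have -> : m.+1%:R * (rho * (q * rho) ^+ m.+1) =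
    q * (m.+1%:R * (rho * rho * (q * rho) ^+ m)) by rewrite exprS; ring.
have C0 : 0 <= m.+1%:R * (rho * rho * (q * rho) ^+ m).
  by rewrite !mulr_ge0 ?exprn_ge0 ?mulr_ge0 ?(ltW q0) ?(ltW rho0).
apply: le_trans (ler_wpM2r C0 (Qq i)).
rewrite /conv_quad mulr_suml; apply: le_trans (ler_norm_sum _ _ _) _; apply: ler_sum => j _.
rewrite mulr_suml; apply: le_trans (ler_norm_sum _ _ _) _; apply: ler_sum => k _.
rewrite normrM ler_wpM2l// /cauchy_prod.
have -> : m.+1%:R * (rho * rho * (q * rho) ^+ m) =
    \sum_(l < m.+1) rho * rho * (q * rho) ^+ m.
  by rewrite sumr_const card_ord mulr_natl.
apply: le_trans (ler_norm_sum _ _ _) _; apply: ler_sum => l _.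
have -> : (q * rho) ^+ m = (q * rho) ^+ l * (q * rho) ^+ (m - l).
  by rewrite -exprD subnKC ?leq_ord.
rewrite normrM mulrACA; apply: ler_pM => //; apply: IH.
  by rewrite ltnS leq_ord.
by rewrite ltnS leq_subr.
Qed.

Definition conv_radius := (q * rho)^-1.

Lemma conv_radius_gt0 : 0 < conv_radius.
Proof. by rewrite invr_gt0 mulr_gt0. Qed.

Lemma ode_coef_pcvg i : pcvg conv_radius (ode_coef^~ i).
Proof.
apply: (@pcvg_geometric _ _ rho); first exact: mulr_gt0.
by move=> m; exact: ode_coef_bound.
Qed.

Definition sol i t := psum (ode_coef^~ i) t.
(** The series of (sol i t - b i) / t, which gives the singular term of the equation a meaning at t
    = 0. *)
Definition solS i t := psum (fun m => ode_coef m.+1 i) t.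

Lemma sol0 i : sol i 0 = b i. Proof. by rewrite /sol psum0. Qed.

Lemma is_derive_sol i (t : R) : `|t| < conv_radius ->
  is_derive t (1 : R) (sol i) (quad (sol^~ t) (sol^~ t) i - d i * solS i t).
Proof.
move=> tr; have H := is_derive_psum (ode_coef_pcvg (i:=i)) tr.
have Hs : pcvg conv_radius (fun m => ode_coef m.+1 i).
  by move=> x xr; exact: (psum_shift (ode_coef_pcvg (i:=i)) xr).1.
have Hd := pcvg_diffs (ode_coef_pcvg (i:=i)).
have Hds : pcvg conv_radius (fun m => d i * ode_coef m.+1 i).
  by move=> x xr; exact: (psumZ (d i) Hs xr).1.
suff E : psum (pseries_diffs (ode_coef^~ i)) t + d i * solS i t =
    quad (sol^~ t) (sol^~ t) i by rewrite -E addrK.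
rewrite -(psumZ (d i) Hs tr).2 -(psumD Hd Hds tr).2.
have -> : (fun n => pseries_diffs (ode_coef^~ i) n + d i * ode_coef n.+1 i) =
    conv_quad ode_coef ^~ i.
  by apply/funext => m; rewrite -ode_coefS mulrDl.
have H1 j k : pcvg conv_radius (cauchy_prod (ode_coef^~ j) (ode_coef^~ k)).
  by move=> x xr; exact: (psumM (ode_coef_pcvg (i:=j)) (ode_coef_pcvg (i:=k)) xr).1.
have H2 j k : pcvg conv_radius (fun m => Q i j k * cauchy_prod (ode_coef^~ j) (ode_coef^~ k) m).
  by move=> x xr; exact: (psumZ _ (H1 j k) xr).1.
have H3 j : pcvg conv_radius (fun m => \sum_k Q i j k * cauchy_prod (ode_coef^~ j) (ode_coef^~ k) m).
  by move=> x xr; exact: (psum_sum _ (H2 j) xr).1.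
rewrite /conv_quad (psum_sum _ H3 tr).2; apply: eq_bigr => j _.
rewrite (psum_sum _ (H2 j) tr).2; apply: eq_bigr => k _.
by rewrite (psumZ _ (H1 j k) tr).2 (psumM (ode_coef_pcvg (i:=j)) (ode_coef_pcvg (i:=k)) tr).2.
Qed.

(** [pi] marks the unknowns that are odd in t. In the term t Q_i the factor t reverses the parity of
    a product, which explains the negation in the condition on [Q]. *)
Lemma ode_coef_parity (pi : 'I_N -> bool) :
  (forall i j k, Q i j k != 0 -> pi i = ~~ (pi j (+) pi k)) ->
  (forall i, pi i -> b i = 0) ->
  forall m i, odd m (+) pi i -> ode_coef m i = 0.
Proof.
move=> Qpi bpi; elim/ltn_ind => -[|m] IH i.
  by rewrite /= ode_coef0; exact: bpi.
move=> mi; have m0 : m.+1%:R + d i != 0 by rewrite gt_eqF// ltr_wpDr// ltr0n.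
apply: (mulfI m0); rewrite ode_coefS mulr0.
rewrite /conv_quad big1// => j _; rewrite big1// => k _.
have [->|Qn0] := eqVneq (Q i j k) 0; first by rewrite mul0r.
rewrite [cauchy_prod _ _ _]big1 ?mulr0// => l _.
have [lj|lj] := boolP (odd l (+) pi j); first by rewrite IH ?mul0r// ltnS leq_ord.
rewrite [X in _ * X]IH ?mulr0// ?ltnS ?leq_subr//.
rewrite oddB ?leq_ord//; move: mi lj; rewrite (Qpi _ _ _ Qn0) /=.
by case: (odd m) (odd l) (pi j) (pi k) => -[] [] [].
Qed.

End QuadraticSystem.

(** * Real calculus *)

Section RealCalculus.
Variable R : realType.
Implicit Types (f g : R -> R) (t a b : R).

(* Not a type class, unlike [is_derive], so that the derivative is found by
   unification. *)
Definition has_deriv f t a : Prop := is_derive t 1 f a.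

Lemma hd_eq f t a b : has_deriv f t a -> a = b -> has_deriv f t b.
Proof. by move=> H <-. Qed.

Lemma hd_unique f t a b : has_deriv f t a -> has_deriv f t b -> a = b.
Proof. by move=> [_ <-] [_ <-]. Qed.

Lemma hd_near f g t a : {near t, f =1 g} -> has_deriv f t a -> has_deriv g t a.
Proof. exact: near_eq_is_derive. Qed.

Lemma hd_open (U : set R) f g t a : open U -> U t -> (forall x, U x -> f x = g x) ->
  has_deriv f t a -> has_deriv g t a.
Proof. by move=> oU Ut fg; apply: hd_near; exact: near_eq_on oU fg t Ut. Qed.

Lemma hd_cont f t a : has_deriv f t a -> {for t, continuous f}.
Proof. exact: is_derive_continuous. Qed.

Lemma hd_cst (c : R) t : has_deriv (fun=> c) t 0.
Proof. exact: is_derive_cst. Qed.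

Lemma hd_id t : has_deriv (fun x => x) t 1.
Proof. exact: is_derive_id. Qed.

Lemma hdD f g t a b : has_deriv f t a -> has_deriv g t b ->
  has_deriv (fun x => f x + g x) t (a + b).
Proof. exact: is_deriveD. Qed.

Lemma hdN f t a : has_deriv f t a -> has_deriv (fun x => - f x) t (- a).
Proof. exact: is_deriveN. Qed.

Lemma hdM f g t a b : has_deriv f t a -> has_deriv g t b ->
  has_deriv (fun x => f x * g x) t (f t * b + g t * a).
Proof. exact: is_deriveM. Qed.

Lemma hdX f n t a : has_deriv f t a ->
  has_deriv (fun x => f x ^+ n) t (n%:R * f t ^+ n.-1 * a).
Proof.
move=> H; have -> : (fun x => f x ^+ n) = f ^+ n by apply/funext => x; rewrite fctE.
exact: is_deriveX.
Qed.

Lemma hd_comp f g t a b : has_deriv f (g t) a -> has_deriv g t b ->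
  has_deriv (fun x => f (g x)) t (a * b).
Proof. exact: is_derive1_comp. Qed.

Lemma hd_exp f t a : has_deriv f t a ->
  has_deriv (fun x => expR (f x)) t (expR (f t) * a).
Proof. by apply: hd_comp; exact: is_derive_expR. Qed.

Lemma hd_sin f t a : has_deriv f t a ->
  has_deriv (fun x => sin (f x)) t (cos (f t) * a).
Proof. by apply: hd_comp; exact: is_derive_sin. Qed.

Lemma hd_cos f t a : has_deriv f t a ->
  has_deriv (fun x => cos (f x)) t (- sin (f t) * a).
Proof. by apply: hd_comp; exact: is_derive_cos. Qed.

Lemma hd_mvt f (df : R -> R) (x y : R) : x < y ->
  (forall t, x <= t <= y -> has_deriv f t (df t)) ->
  exists2 c, x < c < y & f y - f x = df c * (y - x).
Proof.
move=> xy H.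
have Hd t : t \in `]x, y[ -> is_derive t 1 f (df t).
  by rewrite in_itv/= => /andP[/ltW ? /ltW ?]; apply: H; apply/andP.
have Hc : {within `[x, y], continuous f}.
  apply: continuous_in_subspaceT => t; rewrite inE/= in_itv/= => txy.
  exact: hd_cont (H t txy).
have [c cxy E] := MVT xy Hd Hc.
by exists c => //; rewrite in_itv/= in cxy.
Qed.

Lemma hd0_cst f (x y : R) :
  (forall t, x <= t <= y -> has_deriv f t 0) -> x <= y -> f x = f y.
Proof.
move=> H; rewrite le_eqVlt => /orP[/eqP -> //|xy].
have [c _] := hd_mvt (df := fun=> 0) xy H.
by rewrite mul0r => /eqP; rewrite subr_eq0 => /eqP.
Qed.

Lemma hd_ge f (df : R -> R) (m x y : R) : x <= y ->
  (forall t, x <= t <= y -> has_deriv f t (df t)) ->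
  (forall t, x <= t <= y -> m <= df t) -> f x + m * (y - x) <= f y.
Proof.
rewrite le_eqVlt => /orP[/eqP -> _ _|xy H mdf]; first by rewrite subrr mulr0 addr0.
have [c /andP[xc cy] E] := hd_mvt xy H.
rewrite -lerBrDl E ler_wpM2r ?subr_ge0 ?(ltW xy)// mdf//.
by rewrite (ltW xc) (ltW cy).
Qed.

Lemma hd_caratheodory f t a : has_deriv f t a <->
  exists g, [/\ forall z, f z - f t = g z * (z - t), {for t, continuous g} & g t = a].
Proof. exact: is_derive1_caratheodory. Qed.

(** The Caratheodory slopes of [f] and [g] share the value [a] at [t], so the slope obtained by
    gluing them is continuous there. *)
Lemma hd_glue f g t a : f t = g t -> has_deriv f t a -> has_deriv g t a ->
  has_deriv (fun x => if x <= t then f x else g x) t a.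
Proof.
move=> fg /hd_caratheodory[F [fE Fc Fa]] /hd_caratheodory[G [gE Gc Ga]].
apply/hd_caratheodory; exists (fun x => if x <= t then F x else G x); split.
- by move=> z; rewrite lexx; case: ifP => _; rewrite ?fE// fg gE.
- apply/cvgrPdist_lt => e e0; rewrite lexx.
  move/cvgrPdist_lt : Fc => /(_ e e0) HF.
  move/cvgrPdist_lt : Gc => /(_ e e0) HG.
  near=> z; case: ifP => _; first by near: z; exact: HF.
  by rewrite Fa -Ga; near: z; exact: HG.
by rewrite lexx.
Unshelve. all: by end_near. Qed.

Lemma hd_first_zero f t a t0 : t0 < t -> has_deriv f t a ->
  (forall s, t0 <= s < t -> 0 < f s) -> f t = 0 -> a <= 0.
Proof.
move=> t0t /hd_caratheodory[g [gE gc ga]] fpos ft.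
rewrite leNgt; apply/negP => a0.
have : \forall z \near t, 0 < g z.
  by apply: (cvgr_gt _ gc); rewrite ga.
move=> /nbhs_ballP[e /= e0 He].
pose z := Num.max t0 (t - e / 2).
have zt : z < t by rewrite gt_max t0t/= ltrBlDr ltrDl divr_gt0.
have t0z : t0 <= z by rewrite le_max lexx.
have ez : t - e / 2 <= z by rewrite le_max lexx orbT.
have gz : 0 < g z.
  by apply: He; rewrite /ball/= gtr0_norm ?subr_gt0//; lra.
have := gE z; rewrite ft subr0 => E.
have : 0 < f z by apply: fpos; rewrite t0z.
by rewrite E pmulr_rgt0// subr_gt0 ltNge (ltW zt).
Qed.

(** Let c be the supremum of the times up to which all functions stay positive. One that vanished at
    c would have a nonpositive derivative there by [hd_first_zero], against the strict sign
    condition. So all are positive at c and, [J] being finite, on a common neighbourhood of c, which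
    pushes the supremum further. *)
Lemma invariant_region (J : finType) (g dg : J -> R -> R) (t0 T : R) :
  (forall j t, t0 <= t < T -> has_deriv (g j) t (dg j t)) ->
  (forall j, 0 < g j t0) ->
  (forall t, t0 <= t < T -> (forall i, 0 <= g i t) ->
     forall j, g j t = 0 -> 0 < dg j t) ->
  forall t, t0 <= t < T -> forall j, 0 < g j t.
Proof.
move=> gd g0 key t1 /andP[t01 t1T].
pose A := [set t | t0 <= t <= t1 /\ forall s, t0 <= s <= t -> forall j, 0 < g j s].
have A0 : A t0.
  split; first by rewrite lexx.
  by move=> s ss; have <- : t0 = s by apply/eqP; rewrite eq_le.
have Aub : ubound A t1 by move=> t [/andP[]].
have hsA : has_sup A by split; [exists t0|exists t1].
pose c := sup A.
have t0c : t0 <= c by exact: sup_upper_bound.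
have ct1 : c <= t1 by apply: ge_sup => //; exists t0.
have cT : t0 <= c < T by rewrite t0c (le_lt_trans ct1).
have below s : t0 <= s < c -> forall j, 0 < g j s.
  move=> /andP[t0s sc]; have [u [_ uA] su] : exists2 u, A u & s < u.
    by apply: sup_gt => //; exists t0.
  by apply: uA; rewrite t0s ltW.
have gc j : {for c, continuous (g j)} by exact: hd_cont (gd j c cT).
have gpos : forall j, 0 < g j c.
  have [->//|nct0] := eqVneq c t0.
  have t0c' : t0 < c by rewrite lt_neqAle eq_sym nct0.
  have gge j : 0 <= g j c.
    rewrite leNgt; apply/negP => gneg.
    have : \forall z \near c, g j z < 0 by apply: (cvgr_lt _ (gc j)).
    move=> /nbhs_ballP[e /= e0 He].
    pose z := Num.max t0 (c - e / 2).
    have zt : z < c by rewrite gt_max t0c'/= ltrBlDr ltrDl divr_gt0.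
    have t0z : t0 <= z by rewrite le_max lexx.
    have ez : c - e / 2 <= z by rewrite le_max lexx orbT.
    have : g j z < 0 by apply: He; rewrite /ball/= gtr0_norm ?subr_gt0//; lra.
    by rewrite ltNge (ltW (below z _ j))// t0z.
  move=> j; rewrite lt_neqAle gge andbT eq_sym; apply/eqP => gj0.
  have := key c cT gge j gj0; rewrite ltNge => /negP; apply.
  apply: (hd_first_zero t0c' (gd j c cT)) => // s ss; exact: below.
have near_pos : \forall z \near c, forall j, 0 < g j z.
  have H j : \forall z \near c, 0 < g j z by apply: (cvgr_gt _ (gc j)).
  exact: (@filter_forall R J (fun j => [set z | 0 < g j z]) (nbhs c) _ H).
case: (ltgtP c t1) ct1 => // [ct1 _|<- _]; last exact: gpos.
move/nbhs_ballP : near_pos => [e /= e0 He].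
pose u := Num.min t1 (c + e / 2).
have cu : c < u by rewrite lt_min ct1/= ltrDl divr_gt0.
have : A u.
  split; first by rewrite (le_trans t0c (ltW cu)) ge_min lexx.
  move=> s /andP[t0s su] j; have [sc|cs] := ltP s c; first by apply: below; rewrite t0s.
  have uce : u <= c + e / 2 by rewrite ge_min lexx orbT.
  by apply: He; rewrite /ball/= ler0_norm ?subr_le0//; lra.
by move=> /(sup_upper_bound hsA); rewrite leNgt cu.
Qed.

End RealCalculus.

Ltac hd_rules := repeat first
  [ eassumption | eapply hd_cst | eapply hd_id | eapply hdD | eapply hdN | eapply hdX
  | eapply hdM | eapply hd_exp | eapply hd_sin | eapply hd_cos ].
Ltac hd_ring := eapply hd_eq; [hd_rules | rewrite /=; try ring].

(** * The flow of the reduced system *)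

Section Flow.
Variable R : realType.

(* A trajectory records the angle [psi] as a function of [t = log r], together
   with [v = psi'], [p = psi'' / psi'], [w = sin psi / psi'], [C = cos psi] and
   [S = sin psi]. *)
Record traj := Traj { tv : R -> R; tp : R -> R; tw : R -> R;
  tC : R -> R; tS : R -> R; tpsi : R -> R }.

(** This is psi''' / psi' - p^2, with psi''' taken from the zero level of the first integral. *)
Definition pdot (v p w S : R) : R :=
  - p ^+ 2 / 2 + 3 / 2 * v ^+ 2 + 5 - 3 * S ^+ 2 - 9 / 2 * w ^+ 2.

Record flow_at (y : traj) (t : R) : Prop := FlowAt {
  fl_v : has_deriv (tv y) t (tp y t * tv y t);
  fl_p : has_deriv (tp y) t (pdot (tv y t) (tp y t) (tw y t) (tS y t));
  fl_w : has_deriv (tw y) t (tC y t - tp y t * tw y t);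
  fl_C : has_deriv (tC y) t (- tS y t * tv y t);
  fl_S : has_deriv (tS y) t (tC y t * tv y t);
  fl_psi : has_deriv (tpsi y) t (tv y t) }.

(** A system can thus be written as a bilinear form on sequences, convenient for [ring], while the
    existence argument takes its tensor of coefficients. *)
Definition form_tensor N (B : (nat -> R) -> (nat -> R) -> nat -> R) :
    'I_N -> 'I_N -> 'I_N -> R :=
  fun i j k => B (fun l => (l == j :> nat)%:R) (fun l => (l == k :> nat)%:R) i.

Lemma big_inord n (F : 'I_n.+1 -> R) :
  \sum_j F j = \sum_(0 <= j < n.+1) F (inord j).
Proof. by rewrite big_mkord; apply: eq_bigr => j _; rewrite inord_val. Qed.

(* The constant 1 is carried as component 0 to make the system homogeneous. *)
Definition flow_form (y z : nat -> R) (i : nat) : R :=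
  match i with
  | 1%N => y 2%N * z 1%N
  | 2%N => - (y 2%N * z 2%N) / 2 + 3 / 2 * (y 1%N * z 1%N) + 5 * (y 0%N * z 0%N)
         - 3 * (y 5%N * z 5%N) - 9 / 2 * (y 3%N * z 3%N)
  | 3%N => y 4%N * z 0%N - y 2%N * z 3%N
  | 4%N => - y 5%N * z 1%N
  | 5%N => y 4%N * z 1%N
  | 6%N => y 1%N * z 0%N
  | _ => 0
  end.

Lemma quad_flow_form (y z : 'I_7 -> R) (i : nat) : (i < 7)%N ->
  quad (@form_tensor 7 flow_form) y z (inord i) =
  flow_form (fun l => y (inord l)) (fun l => z (inord l)) i.
Proof.
move=> i7; rewrite /quad big_inord.
under eq_bigr do rewrite big_inord.
rewrite /form_tensor /index_iota /= !big_cons !big_nil.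
rewrite !inordK//.
by case: i i7 => [|[|[|[|[|[|[|//]]]]]]] _; rewrite /=; ring.
Qed.

Lemma quad_bound N (Q : 'I_N -> 'I_N -> 'I_N -> R) :
  exists2 q : R, 0 < q & forall i, \sum_j \sum_k `|Q i j k| <= q.
Proof.
pose F i := \sum_j \sum_k `|Q i j k|.
have F0 i : 0 <= F i by rewrite sumr_ge0// => j _; rewrite sumr_ge0.
exists (1 + \sum_i F i); first by rewrite ltr_pwDl// sumr_ge0.
move=> i; rewrite -/(F i) [\sum_i F i](bigD1 i)//=.
by rewrite addrCA lerDl addr_ge0// sumr_ge0.
Qed.

(** The lifetime [h] is chosen before the initial data and depends on [K] only, which allows
    continuation by steps of constant length. *)
Lemma flow_local (K : R) : 0 < K -> exists2 h : R, 0 < h &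
  forall v p w C S psi : R,
  `|v| <= K -> `|p| <= K -> `|w| <= K -> `|C| <= K -> `|S| <= K -> `|psi| <= K ->
  exists y : traj,
    [/\ tv y 0 = v, tp y 0 = p & tw y 0 = w] /\
    [/\ tC y 0 = C, tS y 0 = S & tpsi y 0 = psi] /\
    forall t, `|t| < h -> flow_at y t.
Proof.
move=> K0; pose Q := @form_tensor 7 flow_form; have [q q0 Qq] := quad_bound Q.
(* The bound is [K + 1] because the initial vector also contains the constant component 1. *)
have K1 : 0 < K + 1 by rewrite addr_gt0.
pose h := conv_radius q (K + 1); have h0 : 0 < h by exact: conv_radius_gt0.
exists h => // v p w C S psi vK pK wK CK SK psiK.
pose b (i : 'I_7) : R := nth 0 [:: 1; v; p; w; C; S; psi] i.
have bK i : `|b i| <= K + 1.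
  have le1 x : `|x| <= K -> `|x| <= K + 1 by move=> H; apply: le_trans H _; rewrite lerDl.
  case: i => -[|[|[|[|[|[|[|//]]]]]]] ?; rewrite /b /=; try exact: le1.
  by rewrite normr1 lerDr ltW.
pose Y (l : nat) := sol Q (fun=> 0) b (inord l).
have Y0 l : (l < 7)%N -> Y l 0 = nth 0 [:: 1; v; p; w; C; S; psi] l.
  by move=> l7; rewrite /Y sol0 /b inordK.
have dY l t : (l < 7)%N -> `|t| < h -> has_deriv (Y l) t (flow_form (Y^~ t) (Y^~ t) l).
  move=> l7 th; have H := @is_derive_sol R 7 Q (fun=> 0) b (fun=> lexx 0) q (K + 1) q0 K1 Qq bK (inord l) t th.
  apply: (hd_eq H).
  by rewrite mul0r subr0 quad_flow_form.
have one t : `|t| < h -> Y 0%N t = 1.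
  move=> th; rewrite -[RHS](Y0 0%N)//.
  have [t0|t0] := leP 0 t; [apply: esym|]; apply: hd0_cst => //; try exact: ltW.
  - move=> s /andP[s0 st]; apply: (dY 0%N) => //.
    by rewrite ger0_norm// (le_lt_trans st)// (le_lt_trans (ler_norm _) th).
  - move=> s /andP[s0 st]; apply: (dY 0%N) => //.
    by rewrite ler0_norm// (le_lt_trans _ th)// ltr0_norm// lerN2.
exists (Traj (Y 1%N) (Y 2%N) (Y 3%N) (Y 4%N) (Y 5%N) (Y 6%N)).
split; first by split; rewrite /= Y0.
split; first by split; rewrite /= Y0.
move=> t th; have Y0t := one t th; split => /=.
- exact: hd_eq (dY 1%N t isT th) _.
- by apply: hd_eq (dY 2%N t isT th) _; rewrite /= Y0t /pdot; ring.
- by apply: hd_eq (dY 3%N t isT th) _; rewrite /= Y0t mulr1.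
- exact: hd_eq (dY 4%N t isT th) _.
- exact: hd_eq (dY 5%N t isT th) _.
- by apply: hd_eq (dY 6%N t isT th) _; rewrite /= Y0t mulr1.
Qed.

Definition traj_glue (t0 : R) (y z : traj) : traj :=
  let c f g t : R := if t <= t0 then f t else g t in
  Traj (c (tv y) (tv z)) (c (tp y) (tp z)) (c (tw y) (tw z))
       (c (tC y) (tC z)) (c (tS y) (tS z)) (c (tpsi y) (tpsi z)).

Definition traj_shift (s : R) (y : traj) : traj :=
  let c (f : R -> R) t := f (t - s) in
  Traj (c (tv y)) (c (tp y)) (c (tw y)) (c (tC y)) (c (tS y)) (c (tpsi y)).

Definition traj_eq_at (y z : traj) t : Prop :=
  [/\ tv y t = tv z t, tp y t = tp z t & tw y t = tw z t] /\
  [/\ tC y t = tC z t, tS y t = tS z t & tpsi y t = tpsi z t].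

Lemma flow_shift s y t : flow_at y (t - s) -> flow_at (traj_shift s y) t.
Proof.
have H (f : R -> R) a : has_deriv f (t - s) a -> has_deriv (fun t => f (t - s)) t a.
  move=> fa; rewrite -[a]mulr1; apply: (hd_comp (g := fun t => t - s)) => //.
  by rewrite -[1]addr0; apply: hdD; [exact: hd_id|exact: hd_cst].
by case=> *; split; exact: H.
Qed.

(** The velocity depends only on the values of the six components, so both pieces have the same
    derivatives at [t0] and [hd_glue] applies to each component. *)
Lemma flow_glue t0 y z t : traj_eq_at y z t0 ->
  (t <= t0 -> flow_at y t) -> (t0 <= t -> flow_at z t) -> flow_at (traj_glue t0 y z) t.
Proof.
case: y z => v p w C S psi [v' p' w' C' S' psi'] [[/= ev ep ew] [/= eC eS epsi]].
have left f g a : t < t0 -> has_deriv f t a ->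
    has_deriv (fun t => if t <= t0 then f t else g t) t a.
  move=> tt0; apply: (hd_open (@open_lt R t0)) => // x /= xt0.
  by rewrite ltW.
have right f g a : t0 < t -> has_deriv g t a ->
    has_deriv (fun t => if t <= t0 then f t else g t) t a.
  move=> tt0; apply: (hd_open (@open_gt R t0)) => // x /= xt0.
  by rewrite leNgt xt0.
case: (ltgtP t t0) => [tt0 /(_ isT) H _|tt0 _ /(_ isT) H|-> /(_ isT) [H1 H2 H3 H4 H5 H6] /(_ isT) [G1 G2 G3 G4 G5 G6]].
- by case: H => *; split; rewrite /traj_glue/= (ltW tt0); exact: left.
- by case: H => *; split; rewrite /traj_glue/= leNgt tt0/=; exact: right.
split; rewrite /traj_glue/= lexx; apply: hd_glue => //=.
- by move: G1; rewrite /= ev ep.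
- by move: G2; rewrite /= ev ep ew eS.
- by move: G3; rewrite /= ep ew eC.
- by move: G4; rewrite /= ev eS.
- by move: G5; rewrite /= ev eC.
- by move: G6; rewrite /= ev.
Qed.

End Flow.

(** * Conserved relations, trapping region and continuation *)

Section Continuation.
Variable R : realType.
Implicit Types (y z : traj R) (t s : R).

Definition angle_at y t : Prop :=
  [/\ tS y t = tw y t * tv y t, tS y t = sin (tpsi y t) & tC y t = cos (tpsi y t)].

Lemma angle_circle y t : angle_at y t -> tC y t ^+ 2 + tS y t ^+ 2 = 1.
Proof. by case=> _ -> ->; rewrite cos2Dsin2. Qed.

(** Both w v and S have derivative C v, so their difference is conserved. The points (C, S) and (cos
    psi, sin psi) rotate with the same angular speed v, so their distance is conserved too. *)
Lemma flow_angle y s t : (forall u, s <= u <= t -> flow_at y u) -> s <= t ->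
  angle_at y s -> angle_at y t.
Proof.
move=> fy st [E1 E2 E3].
have K1 : tw y s * tv y s - tS y s = tw y t * tv y t - tS y t.
  apply: (hd0_cst (f := fun u => tw y u * tv y u - tS y u)) => // u su.
  have [Hv _ Hw _ HS _] := fy u su.
  hd_ring.
have K2 : (tS y s - sin (tpsi y s)) ^+ 2 + (tC y s - cos (tpsi y s)) ^+ 2 =
          (tS y t - sin (tpsi y t)) ^+ 2 + (tC y t - cos (tpsi y t)) ^+ 2.
  apply: (hd0_cst (f := fun u => (tS y u - sin (tpsi y u)) ^+ 2 +
    (tC y u - cos (tpsi y u)) ^+ 2)) => // u su.
  have [_ _ _ HC HS Hpsi] := fy u su.
  hd_ring.
have {K2} : (tS y t - sin (tpsi y t)) ^+ 2 + (tC y t - cos (tpsi y t)) ^+ 2 = 0.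
  by rewrite -K2 -E2 -E3 !subrr expr0n/= addr0.
move/eqP; rewrite paddr_eq0 ?sqr_ge0// !sqrf_eq0 !subr_eq0 => /andP[/eqP H1 /eqP H2].
split => //; apply/eqP; rewrite eq_sym -subr_eq0 -K1 E1 subrr//.
Qed.

Definition region_at y t : Prop :=
  [/\ 0 < tv y t, 2 < tp y t, `|tw y t| < 3 / 5 & tp y t < tv y t + 4].

(** The flow points strictly inwards on every face. On p = 2, since S = w v, p' = 3 - 9/2 w^2 + (3/2
    - 3 w^2) v^2 is positive for w^2 <= 9/25. On |w| = 3/5, |p w| >= 6/5 exceeds |C| <= 1. On p = v
    + 4, v' - p' >= 8 v + 3. *)
Lemma flow_region y t0 T : (forall t, t0 <= t < T -> flow_at y t) ->
  angle_at y t0 -> region_at y t0 ->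
  forall t, t0 <= t < T -> tv y t0 / 2 < tv y t /\ region_at y t.
Proof.
move=> fy ay [v0 p0 w0 pv0].
have ay' t : t0 <= t < T -> angle_at y t.
  move=> /andP[t0t tT]; apply: flow_angle ay => // u /andP[t0u ut].
  by apply: fy; rewrite t0u (le_lt_trans ut).
move: w0; rewrite ltr_norml => /andP[w1 w2].
(* The last function compares v with half of its initial value, so that it is strictly positive at
   [t0]; it also yields a lower bound on the growth of psi. *)
pose g (j : 'I_5) t := nth 0 [:: tp y t - 2; 3 / 5 - tw y t; tw y t + 3 / 5;
  tv y t + 4 - tp y t; tv y t - tv y t0 / 2] j.
pose dp t := pdot (tv y t) (tp y t) (tw y t) (tS y t).
pose dw t := tC y t - tp y t * tw y t.
pose dg (j : 'I_5) t := nth 0 [:: dp t; - dw t; dw t;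
  tp y t * tv y t - dp t; tp y t * tv y t] j.
have gd j t : t0 <= t < T -> has_deriv (g j) t (dg j t).
  move=> tT; have [Hv Hp Hw _ _ _] := fy t tT.
  by case: j => -[|[|[|[|[|//]]]]] jlt; rewrite /g /dg /dp /dw /=; hd_ring.
have g0 j : 0 < g j t0.
  by case: j => -[|[|[|[|[|//]]]]] jlt; rewrite /g /=; lra.
have key t : t0 <= t < T -> (forall i, 0 <= g i t) ->
    forall j, g j t = 0 -> 0 < dg j t.
  move=> tT gi; have aT := ay' t tT; have [Sw _ _] := aT.
  have circ := angle_circle aT.
  have := gi (@Ordinal 5 0 isT); have := gi (@Ordinal 5 1 isT).
  have := gi (@Ordinal 5 2 isT); have := gi (@Ordinal 5 3 isT).
  have := gi (@Ordinal 5 4 isT); rewrite /g /=.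
  move: Sw circ; rewrite /g /dg /dp /dw /pdot /=.
  move: (tv y t) (tp y t) (tw y t) (tC y t) (tS y t) => v p w C S Sw circ h5 h4 h3 h2 h1.
  have C1 : - 1 <= C <= 1.
    have : C ^+ 2 <= 1 by rewrite -circ lerDl sqr_ge0.
    by move=> ?; apply/andP; split; nra.
  have w1' : - (3 / 5) <= w by lra.
  have w2' : w <= 3 / 5 by lra.
  have wsq : w ^+ 2 <= 9 / 25 by nra.
  have v0' : 0 < v by lra.
  case=> -[|[|[|[|[|//]]]]] jlt /= gj.
  - have -> : p = 2 by lra.
    have : w ^+ 2 * v ^+ 2 <= 9 / 25 * v ^+ 2 by rewrite ler_wpM2r ?sqr_ge0.
    have := sqr_ge0 v.
    by rewrite Sw exprMn; lra.
  - have -> : w = 3 / 5 by lra.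
    by case/andP: C1 => ? ?; lra.
  - have -> : w = - (3 / 5) by lra.
    by case/andP: C1 => ? ?; lra.
  - have -> : p = v + 4 by lra.
    have := sqr_ge0 S; have := sqr_ge0 w; lra.
  - by rewrite mulr_gt0//; lra.
move=> t tT; have gpos := invariant_region gd g0 key tT.
have := gpos (@Ordinal 5 0 isT); have := gpos (@Ordinal 5 1 isT).
have := gpos (@Ordinal 5 2 isT); have := gpos (@Ordinal 5 3 isT).
have := gpos (@Ordinal 5 4 isT); rewrite /g /= => h5 h4 h3 h2 h1.
split; first by lra.
split; [lra|lra| |lra].
by rewrite ltr_norml; apply/andP; split; lra.
Qed.

(* [(v + 4) exp (- psi)] is nonincreasing. *)
Lemma flow_growth y t0 T : (forall t, t0 <= t < T -> flow_at y t) ->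
  angle_at y t0 -> region_at y t0 ->
  forall t, t0 <= t < T ->
    tv y t + 4 <= (tv y t0 + 4) * expR (tpsi y t - tpsi y t0) /\
    tpsi y t0 + tv y t0 / 2 * (t - t0) <= tpsi y t.
Proof.
move=> fy ay ry t /andP[t0t tT].
have inT u : t0 <= u <= t -> t0 <= u < T.
  by move=> /andP[-> ut]; rewrite (le_lt_trans ut).
have reg u (H : t0 <= u <= t) := flow_region fy ay ry (inT u H).
split; last first.
  apply: (hd_ge (df := tv y)) => // u H; last exact: ltW (reg u H).1.
  by have [] := fy u (inT u H).
pose f u := - ((tv y u + 4) * expR (- tpsi y u)).
pose df u := (tv y u * (tv y u + 4 - tp y u)) * expR (- tpsi y u).
have fd u : t0 <= u <= t -> has_deriv f u (df u).
  move=> H; have [Hv _ _ _ _ Hpsi] := fy u (inT u H).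
  by rewrite /f /df; hd_ring.
have := hd_ge (m := 0) t0t fd; rewrite mul0r addr0 /f lerN2 => H.
have {H} : (tv y t + 4) * expR (- tpsi y t) <= (tv y t0 + 4) * expR (- tpsi y t0).
  apply: H => u H; have [_ [v0 _ _ pv]] := reg u H.
  by rewrite /df !mulr_ge0 ?expR_ge0 ?subr_ge0 ?(ltW v0) ?(ltW pv).
rewrite -(ler_pM2r (expR_gt0 (tpsi y t))) -mulrA -expRD addNr expR0 mulr1.
by rewrite -mulrA -expRD [- _ + _]addrC.
Qed.

(** While psi is below [A], [flow_growth] keeps v + 4 under [Kv], the region controls p and w, and
    all components are at most [K] in absolute value: the same [h] serves at every step. As psi
    grows at least linearly, finitely many steps suffice. The values up to [t0] are kept, because
    they carry the smoothness at the centre of the ball. *)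
Lemma flow_continue y0 t0 T0 : t0 < T0 -> (forall t, t < T0 -> flow_at y0 t) ->
  angle_at y0 t0 -> region_at y0 t0 ->
  forall A, exists y T t1, [/\ forall t, t < T -> flow_at y t,
    forall t, t <= t0 -> traj_eq_at y y0 t, t0 <= t1 < T & A <= tpsi y t1].
Proof.
move=> t0T0 fy0 ay0 ry0 A.
pose Kv := (tv y0 t0 + 4) * expR (A - tpsi y0 t0).
pose K := 1 + Kv + `|A| + `|tpsi y0 t0|.
have [v0 _ _ _] := ry0.
have Kv0 : 0 < Kv by rewrite mulr_gt0 ?expR_gt0// addr_gt0.
have K0 : 0 < K by rewrite /K -!addrA ltr_pwDl// !addr_ge0// ltW.
have [h h0 loc] := flow_local K0.
pose tn n := t0 + n%:R * (h / 2).
have tn0 n : t0 <= tn n by rewrite /tn lerDl mulr_ge0// divr_ge0// ltW.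
have eq_refl y : forall t, traj_eq_at y y t by [].
have transfer y : (forall t, t <= t0 -> traj_eq_at y y0 t) ->
    angle_at y t0 /\ region_at y t0.
  move=> /(_ t0 (lexx _)) [[e1 e2 e3] [e4 e5 e6]].
  by rewrite /angle_at /region_at e1 e2 e3 e4 e5 e6.
have step n : (exists y T t1, [/\ forall t, t < T -> flow_at y t,
      forall t, t <= t0 -> traj_eq_at y y0 t, t0 <= t1 < T & A <= tpsi y t1]) \/
    exists y T, [/\ tn n < T, forall t, t < T -> flow_at y t &
      forall t, t <= t0 -> traj_eq_at y y0 t].
  elim: n => [|n [IH|[y [T [nT fy yy0]]]]]; [|by left|].
    by right; exists y0, T0; split => //; rewrite /tn mul0r addr0.
  have tnT : t0 <= tn n < T by rewrite tn0.
  have [Apsi|psiA] := leP A (tpsi y (tn n)); first by left; exists y, T, (tn n).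
  right; have [ay ry] := transfer y yy0.
  have fyT t : t0 <= t < T -> flow_at y t by move=> /andP[_]; exact: fy.
  have [_ [vn pn wn pvn]] := flow_region fyT ay ry tnT.
  have [growth lower] := flow_growth fyT ay ry tnT.
  have [_ Ssin Ccos] : angle_at y (tn n).
    apply: flow_angle ay => // u /andP[t0u ut].
    by apply: fy; rewrite (le_lt_trans ut).
  have [[e1 _ _] [_ _ e6]] := yy0 t0 (lexx _).
  have vK : tv y (tn n) + 4 <= Kv.
    apply: le_trans growth _; rewrite /Kv e1 e6 ler_wpM2l ?addr_ge0 ?(ltW v0)//.
    by rewrite ler_expR lerD2r ltW.
  have psilow : tpsi y0 t0 <= tpsi y (tn n).
    apply: le_trans lower; rewrite e1 e6 lerDl mulr_ge0// ?subr_ge0//.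
    by rewrite divr_ge0// ltW.
  have n1 := normr_ge0 A; have n2 := normr_ge0 (tpsi y0 t0).
  have n3 := ler_norm A; have n4 := ler_norm (- tpsi y0 t0); rewrite normrN in n4.
  have bv : `|tv y (tn n)| <= K by rewrite gtr0_norm// /K; lra.
  have bp : `|tp y (tn n)| <= K by rewrite gtr0_norm; rewrite /K; lra.
  have bw : `|tw y (tn n)| <= K by apply: le_trans (ltW wn) _; rewrite /K; lra.
  have bC : `|tC y (tn n)| <= K.
    by rewrite Ccos ler_norml; have := cos_le1 (tpsi y (tn n));
       have := cos_geN1 (tpsi y (tn n)); rewrite /K => *; apply/andP; split; lra.
  have bS : `|tS y (tn n)| <= K.
    by rewrite Ssin ler_norml; have := sin_le1 (tpsi y (tn n));
       have := sin_geN1 (tpsi y (tn n)); rewrite /K => *; apply/andP; split; lra.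
  have bpsi : `|tpsi y (tn n)| <= K.
    by rewrite ler_norml /K; apply/andP; split; lra.
  have [z [[z1 z2 z3] [[z4 z5 z6] fz]]] := loc _ _ _ _ _ _ bv bp bw bC bS bpsi.
  pose zs := traj_shift (tn n) z.
  (* The local solution lasts a time [h] and the nodes advance by [h / 2], so the next node lies
     strictly inside the new interval. *)
  exists (traj_glue (tn n) y zs), (tn n + h); split.
  - by rewrite /tn -natr1; lra.
  - move=> t tlt; apply: flow_glue => [|tt|tt].
    + by split; split; rewrite /= subrr.
    + by apply: fy; apply: le_lt_trans nT.
    + apply: flow_shift; apply: fz; rewrite ger0_norm ?subr_ge0//; lra.
  - move=> t tt0; have := yy0 t tt0; rewrite /traj_eq_at/=.
    by rewrite (le_trans tt0 (tn0 n)).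
(* During a step of length [h / 2], psi gains at least [tv y0 t0 / 2 * (h / 2)]; [m] steps carry it
   to [A]. *)
pose m := Num.bound `|(A - tpsi y0 t0) / (tv y0 t0 / 2 * (h / 2))|.
have [//|[y [T [mT fy yy0]]]] := step m.
exists y, T, (tn m); split => //; first by rewrite tn0.
have [ay ry] := transfer y yy0.
have fyT t : t0 <= t < T -> flow_at y t by move=> /andP[_]; exact: fy.
have [|_ lower] := flow_growth fyT ay ry (t := tn m); first by rewrite tn0.
apply: le_trans lower; have [[e1 _ _] [_ _ e6]] := yy0 t0 (lexx _).
have c0 : 0 < tv y0 t0 / 2 * (h / 2) by rewrite mulr_gt0// divr_gt0.
have : (A - tpsi y0 t0) / (tv y0 t0 / 2 * (h / 2)) <= m%:R.
  by apply: le_trans (ler_norm _) _; apply: ltW; exact: archi_boundP (normr_ge0 _).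
rewrite ler_pdivrMr// e1 e6 /tn [t0 + _]addrC addrK.
rewrite lerBlDl mulrCA => H; apply: le_trans H _.
by rewrite le_eqVlt; apply/orP; left; apply/eqP; ring.
Qed.

End Continuation.

(** * The unstable manifold at the origin *)

Section Germ.
Variable R : realType.

(* Unknowns [v, al, be, c, sg, ch] with [p = 3 + P], [w = 1/3 + W], [C = 1 + c],
   [S = v/3 + sg], [psi = v/3 + ch], [al = P + 3W - 3c/4], [be = P - 3W + 3c/2]:
   they diagonalise the linearisation at the rest point, with eigenvalues
   3, -4, -2, 0, 0, 0. With [zeta = r^3] one has [d/dt = 3 zeta d/dzeta], whence
   the division by 3 in [germ_form] and the shifts [1 - eigenvalue / 3]. *)
Definition germP (y : nat -> R) := (y 1%N + y 2%N - 3 / 4 * y 3%N) / 2.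
Definition germW (y : nat -> R) := (y 1%N - y 2%N + 9 / 4 * y 3%N) / 6.
Definition germS (y : nat -> R) := y 0%N / 3 + y 4%N.

Definition germ_form (y z : nat -> R) (i : nat) : R :=
  let f := 3 / 2 * (y 0%N * z 0%N) - 3 * (germS y * germS z)
    - germP y * germP z / 2 - 9 / 2 * (germW y * germW z) in
  let g := - (germP y * germW z) in
  match i with
  | 0%N => germP y * z 0%N
  | 1%N => f + 3 * g + 3 / 4 * (germS y * z 0%N)
  | 2%N => f - 3 * g - 3 / 2 * (germS y * z 0%N)
  | 3%N => - (germS y * z 0%N)
  | 4%N => y 3%N * z 0%N - germP y * z 0%N / 3
  | 5%N => - (germP y * z 0%N / 3)
  | _ => 0
  end / 3.

Definition germ_shift (i : 'I_6) : R := nth 0 [:: 0; 7 / 3; 5 / 3; 1; 1; 1] i.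
(** The coefficient of zeta in v is free because its shift is 0; another positive value would only
    translate t. *)
Definition germ_init (i : 'I_6) : R := (i == 0 :> nat)%:R.
(** This is the symmetry zeta -> - zeta, psi -> - psi, under which v and S change sign while p, w
    and C do not. The flags concern the unknowns divided by zeta, so their parity is the opposite of
    that of the unknowns. *)
Definition germ_odd (i : 'I_6) : bool := nth false [:: false; true; true; true; false; false] i.

Lemma quad_germ_form (y z : 'I_6 -> R) (i : nat) : (i < 6)%N ->
  quad (@form_tensor R 6 germ_form) y z (inord i) =
  germ_form (fun l => y (inord l)) (fun l => z (inord l)) i.
Proof.
move=> i6; rewrite /quad big_inord.
under eq_bigr do rewrite big_inord.
rewrite /form_tensor /index_iota /= !big_cons !big_nil.
rewrite !inordK//.
by case: i i6 => [|[|[|[|[|[|//]]]]]] _; rewrite /germ_form /germP /germW /germS /=; field.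
Qed.

Lemma germ_tensor_parity i j k : @form_tensor R 6 germ_form i j k != 0 ->
  germ_odd i = ~~ (germ_odd j (+) germ_odd k).
Proof.
apply: contra_neqP => /eqP; rewrite /germ_odd /form_tensor.
case: i j k => -[|[|[|[|[|[|//]]]]]] ? [] [|[|[|[|[|[|//]]]]]] ? [] [|[|[|[|[|[|//]]]]]] ? //= _;
by rewrite /germ_form /germP /germW /germS /=; field.
Qed.

Definition traj_exp (y : traj R) : traj R :=
  let c (f : R -> R) t := f (expR (3 * t)) in
  Traj (c (tv y)) (c (tp y)) (c (tw y)) (c (tC y)) (c (tS y)) (c (tpsi y)).

(** The variable of [g_traj] is zeta = r^3, and smoothness is recorded across zeta = 0, where t is
    no longer a coordinate. [g_S] and [g_C] take zeta^2 = r^6, which is a polynomial in |x|^2,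
    whereas zeta itself is not. *)
Record germ := Germ {
  g_radius : R; g_traj : traj R; g_S : R -> R; g_C : R -> R;
  g_radius_gt0 : 0 < g_radius;
  g_smooth : let U := [set x : R | `|x| < g_radius] in forall n,
    [/\ Ck (@dir1 R) n U (tv g_traj), Ck (@dir1 R) n U (tp g_traj) & Ck (@dir1 R) n U (tw g_traj)] /\
    [/\ Ck (@dir1 R) n U (tC g_traj), Ck (@dir1 R) n U (tS g_traj) & Ck (@dir1 R) n U (tpsi g_traj)];
  g_smooth2 : let U := [set x : R | `|x| < g_radius ^+ 2] in forall n,
    Ck (@dir1 R) n U g_S /\ Ck (@dir1 R) n U g_C;
  g_zero : [/\ tv g_traj 0 = 0, tp g_traj 0 = 3 & tw g_traj 0 = 1 / 3] /\
    [/\ tC g_traj 0 = 1, tS g_traj 0 = 0 & tpsi g_traj 0 = 0];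
  g_pos : exists2 e : R, 0 < e & forall x, 0 < x < e -> 0 < tv g_traj x;
  g_S_even : forall x, `|x| < g_radius -> tS g_traj x = x * g_S (x ^+ 2);
  g_C_even : forall x, `|x| < g_radius -> tC g_traj x = 1 + x ^+ 2 * g_C (x ^+ 2);
  g_flow : forall t, expR (3 * t) < g_radius ->
    flow_at (traj_exp g_traj) t }.

(** Convergence at [z] follows from convergence at a point between |z| and [r ^+ 2], whose square
    root is inside the original disc. *)
Lemma even_part r (a : nat -> R) : 0 < r -> pcvg r a -> (forall n, odd n -> a n = 0) ->
  pcvg (r ^+ 2) (fun m => a m.*2) /\
  forall x, `|x| < r -> psum a x = psum (fun m => a m.*2) (x ^+ 2).
Proof.
move=> r0 ar ao; split=> [z zr|x xr]; last by rewrite (psum_eq (psum_even ar xr ao)).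
pose u := (`|z| + r ^+ 2) / 2.
have zu : `|z| < u by rewrite /u; lra.
have u0 : 0 <= u by apply: le_trans (ltW zu).
have ur : Num.sqrt u < r.
  by rewrite -(ltr_sqr (sqrtr_ge0 _) (ltW r0)) sqr_sqrtr// /u; lra.
apply: (@is_cvg_pseries_inside _ _ u); last by rewrite (ger0_norm u0).
apply/cvg_ex; exists (psum a (Num.sqrt u)); rewrite -{1}(sqr_sqrtr u0).
by apply: psum_even ar _ ao; rewrite ger0_norm ?sqrtr_ge0.
Qed.

Lemma germ_exists : inhabited germ.
Proof.
pose Q := @form_tensor R 6 germ_form; have [q q0 Qq] := quad_bound Q.
have d0 i : 0 <= germ_shift i.
  case: i => -[|[|[|[|[|[|//]]]]]] ?; rewrite /germ_shift /= ?lexx ?ler01// divr_ge0//.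
have b1 i : `|germ_init i| <= 1.
  by rewrite /germ_init; case: eqP => _; rewrite ?normr1 ?normr0.
pose r := conv_radius q 1; have r0 : 0 < r by exact: conv_radius_gt0.
pose a l m := ode_coef Q germ_shift germ_init m (inord l).
have ar l : pcvg r (a l) by exact: (ode_coef_pcvg d0 q0 ltr01 Qq b1).
(* Blowing up by [Y = x X] turns x Y' = (1 - d) Y + Q(Y, Y), the system at the rest point, into x X'
   + d (X - b) = x Q(X, X). *)
pose X l x := psum (a l) x; pose Y l x := x * X l x.
pose XS l x := psum (fun m => a l m.+1) x.
have parity l m : (l < 6)%N -> odd m (+) germ_odd (inord l) -> a l m = 0.
  move=> l6; apply: (ode_coef_parity d0 germ_tensor_parity).
  move=> i; rewrite /germ_odd /germ_init.
  by case: i => -[|[|[|[|[|[|//]]]]]] ?.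
have a0 l : (l < 6)%N -> a l 0%N = (l == 0%N)%:R.
  by move=> l6; rewrite /a ode_coef0 /germ_init inordK.
have XE l x : `|x| < r -> X l x = a l 0%N + x * XS l x.
  by move=> xr; exact: (psum_shift (ar l) xr).2.
have dX l x : (l < 6)%N -> `|x| < r -> has_deriv (X l) x
    (germ_form (X^~ x) (X^~ x) l - germ_shift (inord l) * XS l x).
  move=> l6 xr.
  have H := @is_derive_sol R 6 Q germ_shift germ_init d0 q 1 q0 ltr01 Qq b1 (inord l) x xr.
  by apply: (hd_eq H); rewrite quad_germ_form.
have form_scale x l : germ_form (Y^~ x) (Y^~ x) l = x ^+ 2 * germ_form (X^~ x) (X^~ x) l.
  rewrite /Y /germ_form /germP /germW /germS.
  by case: l => [|[|[|[|[|[|l]]]]]]; field.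
have dY l x : (l < 6)%N -> `|x| < r -> x != 0 ->
    has_deriv (Y l) x (x^-1 * ((1 - germ_shift (inord l)) * Y l x +
      germ_form (Y^~ x) (Y^~ x) l)).
  move=> l6 xr x0; have HX := dX l x l6 xr.
  (* The only nonzero initial value sits at the component of shift 0, so the blown-up equation
     leaves no term linear in [x]. *)
  have dab : germ_shift (inord l) * a l 0%N = 0.
    rewrite a0// /germ_shift inordK//.
    by case: l l6 {XE HX} => [|l] l6; rewrite /= ?mul0r ?mulr0.
  have E : x * (germ_shift (inord l) * XS l x) = germ_shift (inord l) * X l x.
    by rewrite XE// mulrDr dab add0r; ring.
  apply: hd_eq (hdM (hd_id x) HX) _.
  by rewrite form_scale mulrBr E /Y; field.
have CkY l n : Ck (@dir1 R) n [set x : R | `|x| < r] (Y l).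
  apply: (CkM (f := id) (g := X l)); first exact: open_disc.
    exact: Ck1_id.
  exact: Ck1_psum.
have Y0 l : Y l 0 = 0 by rewrite /Y mul0r.
have oU : open [set x : R | `|x| < r] by exact: open_disc.
pose G := Traj (Y 0%N) (fun x => 3 + germP (Y^~ x)) (fun x => 1 / 3 + germW (Y^~ x))
  (fun x => 1 + Y 3%N x) (fun x => germS (Y^~ x)) (fun x => Y 0%N x / 3 + Y 5%N x).
pose aS m := a 0%N m / 3 + a 4%N m.
have aSE : aS = (fun m => 3^-1 * a 0%N m + a 4%N m).
  by apply/funext => m; rewrite /aS mulrC.
have H3 : pcvg r (fun m => 3^-1 * a 0%N m).
  by move=> x xr; exact: (psumZ _ (ar 0%N) xr).1.
have [eS1 eS2] : pcvg (r ^+ 2) (fun m => aS m.*2) /\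
    forall x, `|x| < r -> psum aS x = psum (fun m => aS m.*2) (x ^+ 2).
  apply: even_part => // [x xr|m om].
    by rewrite aSE; exact: (psumD H3 (ar 4%N) xr).1.
  by rewrite /aS !parity ?mul0r ?addr0// /germ_odd inordK//= addbF.
(* C - 1 is [x * X 3 x] with [X 3] odd, hence [x ^+ 2] times an even series. *)
have [eC1 eC2] : pcvg (r ^+ 2) (fun m => a 3%N m.*2.+1) /\
    forall x, `|x| < r -> XS 3%N x = psum (fun m => a 3%N m.*2.+1) (x ^+ 2).
  apply: (@even_part r (fun m => a 3%N m.+1)) => // [x xr|m om].
    exact: (psum_shift (ar 3%N) xr).1.
  by rewrite parity//= om /germ_odd inordK.
have Ccst (c : R) n : Ck (@dir1 R) n [set x : R | `|x| < r] (fun=> c) by exact: Ck_cst.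
have CZ (c : R) l n : Ck (@dir1 R) n [set x : R | `|x| < r] (fun x => c * Y l x).
  exact: CkZ.
constructor; refine (@Germ r G (psum (fun m => aS m.*2)) (psum (fun m => a 3%N m.*2.+1)) r0 _ _ _ _ _ _ _).
- move=> U n; split; split => /=; rewrite /germP /germW /germS.
  + exact: CkY.
  + apply: (Ck_eq (f := cst 3 + (fun x => 2^-1 * Y 1%N x) + (fun x => 2^-1 * Y 2%N x) +
      (fun x => - (3 / 8) * Y 3%N x))) => // [x _|]; first by rewrite !fctE /=; field.
    by do 3 (apply: (CkD oU); last exact: CZ); exact: Ccst.
  + apply: (Ck_eq (f := cst (1 / 3) + (fun x => 6^-1 * Y 1%N x) + (fun x => - 6^-1 * Y 2%N x) +
      (fun x => (9 / 24) * Y 3%N x))) => // [x _|]; first by rewrite !fctE /=; field.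
    by do 3 (apply: (CkD oU); last exact: CZ); exact: Ccst.
  + by apply: (CkD (f := cst 1) oU); [exact: Ccst|exact: CkY].
  + apply: (Ck_eq (f := (fun x => 3^-1 * Y 0%N x) + Y 4%N)) => // [x _|].
      by rewrite !fctE /= mulrC.
    by apply: (CkD oU); [exact: CZ|exact: CkY].
  + apply: (Ck_eq (f := (fun x => 3^-1 * Y 0%N x) + Y 5%N)) => // [x _|].
      by rewrite !fctE /= mulrC.
    by apply: (CkD oU); [exact: CZ|exact: CkY].
- by move=> U n; split; exact: Ck1_psum.
- by split; split; rewrite /= ?/germP ?/germW ?/germS !Y0; field.
- have X0 : 0 < X 0%N 0 by rewrite /X psum0 a0.
  have Xc : {for 0, continuous (X 0%N)}.
    by apply: (Ck_continuous (Ck1_psum 0 (ar 0%N))); rewrite /= normr0.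
  have : \forall x \near (0 : R), 0 < X 0%N x by apply: (cvgr_gt _ Xc).
  move=> /nbhs_ballP[e /= e0 He]; exists e => // x /andP[x0 xe].
  by rewrite /Y mulr_gt0// He// /ball/= sub0r normrN gtr0_norm.
- move=> x xr; rewrite -eS2// aSE (psumD H3 (ar 4%N) xr).2 (psumZ _ (ar 0%N) xr).2.
  by rewrite /= /germS /Y /X; field.
- move=> x xr; rewrite -eC2// /= /Y XE// a0//=.
  by rewrite add0r; ring.
move=> t tr; have e0 := expR_gt0 (3 * t); have en0 := lt0r_neq0 e0.
have er : `|expR (3 * t)| < r by rewrite gtr0_norm.
have de : has_deriv (fun t => expR (3 * t)) t (3 * expR (3 * t)) by hd_ring.
have dYt l (l6 : (l < 6)%N) : has_deriv (fun t => Y l (expR (3 * t))) t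
    (3 * ((1 - nth 0 [:: 0; 7 / 3; 5 / 3; 1; 1; 1] l) * Y l (expR (3 * t)) +
      germ_form (Y^~ (expR (3 * t))) (Y^~ (expR (3 * t))) l)).
  have H := hd_comp (f := Y l) (g := fun t => expR (3 * t)) (dY l _ l6 er en0) de.
  by apply: (hd_eq H); rewrite /germ_shift inordK//; field.
have := (dYt 0%N isT, dYt 1%N isT, dYt 2%N isT, dYt 3%N isT, dYt 4%N isT, dYt 5%N isT).
rewrite /G; clear -en0; clearbody Y => -[[[[[/= d5 d4] d3] d2] d1] d0].
split => /=; rewrite /germP /germW /germS;
  (eapply hd_eq; [hd_rules|]); rewrite /pdot /germ_form /germP /germW /germS /=; by field.
Qed.

End Germ.

(** * The biharmonic equation along the flow *)

Section Profile.
Variable R : realType.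
Implicit Types (y : traj R) (U : set R) (f : R -> R).

Local Notation Ck1 := (Ck (@dir1 R)).

Lemma Ck1_hd U f n k x : Ck1 n U f -> (k < n)%N -> U x ->
  has_deriv (derive1n k f) x (derive1n k.+1 f x).
Proof.
elim: k n f => [|k IH] [//|n] f hf kn Ux.
  have [_ /(_ tt) [fd _]] := hf.
  by rewrite derive1n1 derive1n0 derive1E; apply/derivableP/fd.
rewrite !(derive1Sn _ k) derive1Sn; apply: IH Ux; last exact: kn.
exact: Ck1_derive1 hf.
Qed.

(** Bootstrap: the derivatives are polynomials in the components, so smoothness of order n gives
    order n + 1. *)
Lemma flow_smooth y (T : R) : (forall t, t < T -> flow_at y t) ->
  forall n, let U := [set t | t < T] in
  [/\ Ck1 n U (tv y), Ck1 n U (tp y) & Ck1 n U (tw y)] /\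
  [/\ Ck1 n U (tC y), Ck1 n U (tS y) & Ck1 n U (tpsi y)].
Proof.
move=> fy n U; have oU : open U by exact: open_lt.
elim: n => [|n [[Hv Hp Hw] [HC HS Hpsi]]].
  by split; split; split=> [t /fy[*]|//]; apply: hd_cont; eassumption.
have Cc (c : R) : Ck1 n U (fun=> c) by exact: Ck_cst.
have ap (f g : R -> R) : (forall t, U t -> has_deriv f t (g t)) -> Ck1 n U g -> Ck1 n.+1 U f.
  by move=> H; exact: Ck1_step.
have M (f g : R -> R) : Ck1 n U f -> Ck1 n U g -> Ck1 n U (fun t => f t * g t).
  by move=> *; apply: CkM.
have D (f g : R -> R) : Ck1 n U f -> Ck1 n U g -> Ck1 n U (fun t => f t + g t).
  by move=> *; apply: CkD.
have N (f : R -> R) : Ck1 n U f -> Ck1 n U (fun t => - f t).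
  by move=> *; apply: CkN.
have X (f : R -> R) k : Ck1 n U f -> Ck1 n U (fun t => f t ^+ k).
  by move=> *; apply: CkX.
split; split.
- by apply: (ap _ (fun t => tp y t * tv y t)) => [t /fy[]//|]; exact: M.
- apply: (ap _ (fun t => pdot (tv y t) (tp y t) (tw y t) (tS y t))) => [t /fy[]//|].
  by rewrite /pdot; repeat first [exact: Cc | refine (D _ _ _ _) | refine (N _ _) | refine (X _ _ _); eassumption | refine (M _ _ _ _)].
- apply: (ap _ (fun t => tC y t - tp y t * tw y t)) => [t /fy[]//|].
  by apply: D => //; apply: N; apply: M.
- apply: (ap _ (fun t => - tS y t * tv y t)) => [t /fy[]//|].
  by apply: M => //; exact: N.
- by apply: (ap _ (fun t => tC y t * tv y t)) => [t /fy[]//|]; exact: M.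
- by apply: (ap _ (tv y)) => [t /fy[]//|].
Qed.

Section Chain.
Variables (T : R) (v v1 v2 v3 C S e : R -> R).
Hypothesis dv : forall u, u < T -> has_deriv v u (v1 u).
Hypothesis dv1 : forall u, u < T -> has_deriv v1 u (v2 u).
Hypothesis dv2 : forall u, u < T -> has_deriv v2 u (v3 u).
Hypothesis dC : forall u, u < T -> has_deriv C u (- S u * v u).
Hypothesis dS : forall u, u < T -> has_deriv S u (C u * v u).
Hypothesis de : forall u, has_deriv e u (2 * e u).

Lemma deriv_eq_on f g a b u : (forall t, t < T -> f t = g t) -> u < T ->
  has_deriv f u a -> has_deriv g u b -> a = b.
Proof.
move=> fg uT df dg; apply: (hd_unique (f := g)) dg.
exact: (hd_open (@open_lt R T) uT fg df).
Qed.

(** Derivatives of S computed in two ways. With D = d/du, D (r e^j F_j) = r ((2j + 1) e^j F_j + 2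
    e^(j+1) F_(j+1)); iterating this produces the integers on the right. *)
Lemma sin_chain (r : R -> R) (F_ : nat -> R -> R) :
  (forall u, has_deriv r u (r u)) ->
  (forall k u, (k < 4)%N -> u < T -> has_deriv (F_ k) u (F_ k.+1 u * (2 * e u))) ->
  (forall u, u < T -> S u = r u * F_ 0%N u) -> forall u, u < T ->
  C u * v1 u - S u * v u ^+ 2 =
    r u * (F_ 0%N u + 8 * e u * F_ 1%N u + 4 * e u ^+ 2 * F_ 2%N u) /\
  C u * v3 u - 4 * S u * v u * v2 u - 3 * S u * v1 u ^+ 2
      - 6 * C u * v u ^+ 2 * v1 u + S u * v u ^+ 4 =
    r u * (F_ 0%N u + 80 * e u * F_ 1%N u + 232 * e u ^+ 2 * F_ 2%N u
      + 128 * e u ^+ 3 * F_ 3%N u + 16 * e u ^+ 4 * F_ 4%N u).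
Proof.
move=> dr dF SE.
have E1 u : u < T -> C u * v u = r u * (F_ 0%N u + 2 * e u * F_ 1%N u).
  move=> uT; apply: (deriv_eq_on SE uT); first exact: dS.
  by have := (dr u, dF 0%N u isT uT) => -[Hr H0]; hd_ring.
have E2 u : u < T -> C u * v1 u - S u * v u ^+ 2 =
    r u * (F_ 0%N u + 8 * e u * F_ 1%N u + 4 * e u ^+ 2 * F_ 2%N u).
  have Hr := dr u; have He := de u.
  move=> uT; apply: (deriv_eq_on E1 uT).
    by have Hv := dv uT; have HC := dC uT; hd_ring.
  by have H0 := dF 0%N u isT uT; have H1 := dF 1%N u isT uT; hd_ring.
have E3 u : u < T -> C u * v2 u - 3 * S u * v u * v1 u - C u * v u ^+ 3 =
    r u * (F_ 0%N u + 26 * e u * F_ 1%N u + 36 * e u ^+ 2 * F_ 2%N u + 8 * e u ^+ 3 * F_ 3%N u).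
  have Hr := dr u; have He := de u.
  move=> uT; apply: (deriv_eq_on E2 uT).
    by have Hv := dv uT; have Hv1 := dv1 uT; have HC := dC uT; have HS := dS uT; hd_ring.
  have H0 := dF 0%N u isT uT; have H1 := dF 1%N u isT uT; have H2 := dF 2%N u isT uT.
  by hd_ring.
move=> u uT; split; first exact: E2.
have Hr := dr u; have He := de u.
apply: (deriv_eq_on E3 uT).
  have Hv := dv uT; have Hv1 := dv1 uT; have Hv2 := dv2 uT.
  by have HC := dC uT; have HS := dS uT; hd_ring.
have H0 := dF 0%N u isT uT; have H1 := dF 1%N u isT uT; have H2 := dF 2%N u isT uT.
by have H3 := dF 3%N u isT uT; hd_ring.
Qed.

(** Here D (e^j G_j) = 2j e^j G_j + 2 e^(j+1) G_(j+1). *)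
Lemma cos_chain (G_ : nat -> R -> R) :
  (forall k u, (k < 4)%N -> u < T -> has_deriv (G_ k) u (G_ k.+1 u * (2 * e u))) ->
  (forall u, u < T -> C u = G_ 0%N u) -> forall u, u < T ->
  - S u * v1 u - C u * v u ^+ 2 = 4 * e u * G_ 1%N u + 4 * e u ^+ 2 * G_ 2%N u /\
  - S u * v3 u - 4 * C u * v u * v2 u - 3 * C u * v1 u ^+ 2
      + 6 * S u * v u ^+ 2 * v1 u + C u * v u ^+ 4 =
    16 * e u * G_ 1%N u + 112 * e u ^+ 2 * G_ 2%N u + 96 * e u ^+ 3 * G_ 3%N u
      + 16 * e u ^+ 4 * G_ 4%N u.
Proof.
move=> dG CE.
have K1 u : u < T -> - S u * v u = 2 * e u * G_ 1%N u.
  move=> uT; apply: (deriv_eq_on CE uT); first exact: dC.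
  by have H0 := dG 0%N u isT uT; hd_ring.
have K2 u : u < T -> - S u * v1 u - C u * v u ^+ 2 =
    4 * e u * G_ 1%N u + 4 * e u ^+ 2 * G_ 2%N u.
  move=> uT; have He := de u; apply: (deriv_eq_on K1 uT).
    by have Hv := dv uT; have HS := dS uT; hd_ring.
  by have H1 := dG 1%N u isT uT; hd_ring.
have K3 u : u < T -> - S u * v2 u - 3 * C u * v u * v1 u + S u * v u ^+ 3 =
    8 * e u * G_ 1%N u + 24 * e u ^+ 2 * G_ 2%N u + 8 * e u ^+ 3 * G_ 3%N u.
  move=> uT; have He := de u; apply: (deriv_eq_on K2 uT).
    by have Hv := dv uT; have Hv1 := dv1 uT; have HC := dC uT; have HS := dS uT; hd_ring.
  by have H1 := dG 1%N u isT uT; have H2 := dG 2%N u isT uT; hd_ring.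
move=> u uT; split; first exact: K2.
have He := de u; apply: (deriv_eq_on K3 uT).
  have Hv := dv uT; have Hv1 := dv1 uT; have Hv2 := dv2 uT.
  by have HC := dC uT; have HS := dS uT; hd_ring.
have H1 := dG 1%N u isT uT; have H2 := dG 2%N u isT uT.
by have H3 := dG 3%N u isT uT; hd_ring.
Qed.

End Chain.

(* The biharmonic map equation for the map [x |-> (F(|x|^2) x, G(|x|^2))] of the
   4-ball, at a point with [|x|^2 = s]. *)
Definition bitension_eq (F G : R -> R) (s : R) : Prop :=
  G s * (16 * s ^+ 2 * derive1n 4 F s + 128 * s * derive1n 3 F s + 192 * derive1n 2 F s) =
  F s * (16 * s ^+ 2 * derive1n 4 G s + 96 * s * derive1n 3 G s + 96 * derive1n 2 G s).

(* With [s = exp (2 t)], the two bracketed factors are [exp (- 4 t)] times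
   [(D^2 - 1) (D^2 - 9) S / exp t] and [D^2 (D^2 - 4) C], where [D = d/dt]. *)
Lemma flow_bitension y (T : R) U (F G : R -> R) :
  (forall t, t < T -> flow_at y t) -> (forall t, t < T -> angle_at y t) ->
  (forall t, t < T -> U (expR (2 * t))) -> Ck1 4 U F -> Ck1 4 U G ->
  (forall t, t < T -> tS y t = expR t * F (expR (2 * t))) ->
  (forall t, t < T -> tC y t = G (expR (2 * t))) ->
  forall t s, t < T -> s = expR (2 * t) ->
  bitension_eq F G s.
Proof.
move=> fy ay TU kF kG SE CE t s tT sE.
pose e u : R := expR (2 * u).
have de u : has_deriv e u (2 * e u) by rewrite /e; hd_ring.
have dr u : has_deriv (@expR R) u (expR u) by exact: is_derive_expR.
have dF k u : (k < 4)%N -> u < T ->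
    has_deriv (fun u => derive1n k F (e u)) u (derive1n k.+1 F (e u) * (2 * e u)).
  move=> k4 uT; exact: (@hd_comp R (derive1n k F) e u _ _ (Ck1_hd kF k4 (TU _ uT)) (de u)).
have dG k u : (k < 4)%N -> u < T ->
    has_deriv (fun u => derive1n k G (e u)) u (derive1n k.+1 G (e u) * (2 * e u)).
  move=> k4 uT; exact: (@hd_comp R (derive1n k G) e u _ _ (Ck1_hd kG k4 (TU _ uT)) (de u)).
pose k2 (v p w S : R) := p ^+ 2 / 2 + 3 / 2 * v ^+ 2 + 5 - 3 * S ^+ 2 - 9 / 2 * w ^+ 2.
pose k3 (v p w C S : R) := (p * pdot v p w S + 3 * v * (p * v) - 6 * S * (C * v)
  - 9 * w * (C - p * w)) * v + k2 v p w S * (p * v).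
pose v1 u := tp y u * tv y u.
pose v2 u := k2 (tv y u) (tp y u) (tw y u) (tS y u) * tv y u.
pose v3 u := k3 (tv y u) (tp y u) (tw y u) (tC y u) (tS y u).
have dv u (uT : u < T) : has_deriv (tv y) u (v1 u) by have [] := fy u uT.
have dC u (uT : u < T) : has_deriv (tC y) u (- tS y u * tv y u) by have [] := fy u uT.
have dS u (uT : u < T) : has_deriv (tS y) u (tC y u * tv y u) by have [] := fy u uT.
have dv1 u (uT : u < T) : has_deriv v1 u (v2 u).
  have [Hv Hp _ _ _ _] := fy u uT; rewrite /v1 /v2 /k2.
  by eapply hd_eq; [hd_rules|rewrite /pdot/=; field].
have dv2 u (uT : u < T) : has_deriv v2 u (v3 u).
  have [Hv Hp Hw _ HS _] := fy u uT; rewrite /v2 /v3 /k3 /k2.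
  by eapply hd_eq; [hd_rules|rewrite /pdot/=; field].
have [e2 e4] := sin_chain dv dv1 dv2 dC dS de (F_ := fun k u => derive1n k F (e u)) dr dF SE tT.
have [k2' k4] := cos_chain dv dv1 dv2 dC dS de (G_ := fun k u => derive1n k G (e u)) dG CE tT.
have aT := ay t tT; have circ := angle_circle aT; have [Sw _ _] := aT.
have eS := SE t tT; have eC := CE t tT.
have s0 : 0 < s by rewrite sE expR_gt0.
have r0 := expR_gt0 t.
move: e2 e4 k2' k4 circ Sw eS eC; rewrite /v3 /v2 /v1 /k3 /k2 /pdot /e -sE.
clear -s0 r0; rewrite derive1n0 /bitension_eq.
move: (tC y t) (tS y t) (tv y t) (tp y t) (tw y t) (expR t) r0 => C S v p w r r0.
move: (derive1n 1 F s) (derive1n 2 F s) (derive1n 3 F s) (derive1n 4 F s) => f1 f2 f3 f4.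
move: (derive1n 1 G s) (derive1n 2 G s) (derive1n 3 G s) (derive1n 4 G s) => g1 g2 g3 g4.
move: (F s) (G s) => f0 g0 e2 e4 c2 c4 circ Sw eS eC.
have rs : (r * s ^+ 2) != 0 by rewrite mulf_neq0// ?expf_neq0// gt_eqF.
apply: (mulfI rs).
have -> : r * s ^+ 2 * (g0 * (16 * s ^+ 2 * f4 + 128 * s * f3 + 192 * f2)) =
  g0 * (r * (f0 + 80 * s * f1 + 232 * s ^+ 2 * f2 + 128 * s ^+ 3 * f3 + 16 * s ^+ 4 * f4)
    - 10 * (r * (f0 + 8 * s * f1 + 4 * s ^+ 2 * f2)) + 9 * (r * f0)) by ring.
have -> : r * s ^+ 2 * (f0 * (16 * s ^+ 2 * g4 + 96 * s * g3 + 96 * g2)) =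
  r * f0 * (16 * s * g1 + 112 * s ^+ 2 * g2 + 96 * s ^+ 3 * g3 + 16 * s ^+ 4 * g4
    - 4 * (4 * s * g1 + 4 * s ^+ 2 * g2)) by ring.
rewrite -e2 -e4 -c2 -c4 -eS -eC.
apply/eqP; rewrite -subr_eq0; apply/eqP.
(* The long factor is psi'''' - 6 psi'^2 psi'' - 10 psi''. Along the flow it equals - (6 S^2 psi'' +
   6 S C psi'^2 + 9 S C), the differentiated first integral divided by psi'. The left side is C^2 +
   S^2 times that factor plus these three terms, so only the defect of the circle relation
   remains. *)
transitivity ((C ^+ 2 + S ^+ 2 - 1) *
  ((p * (- p ^+ 2 / 2 + 3 / 2 * v ^+ 2 + 5 - 3 * S ^+ 2 - 9 / 2 * w ^+ 2)
    + 3 * v * (p * v) - 6 * S * (C * v) - 9 * w * (C - p * w)) * v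
   + (p ^+ 2 / 2 + 3 / 2 * v ^+ 2 + 5 - 3 * S ^+ 2 - 9 / 2 * w ^+ 2) * (p * v)
   - 6 * v ^+ 2 * (p * v) - 10 * (p * v))).
  by rewrite Sw; field.
by rewrite circ subrr mul0r.
Qed.

End Profile.

(** * Profiles reaching a prescribed value at radius 1 *)

Section ProfileExists.
Variable R : realType.
Local Notation Ck1 := (Ck (@dir1 R)).

(** The sum of squares [f] of the three defects is constant along the flow. No finite initial time
    is available, so its value is found as the limit at zeta = 0, where the defects vanish. *)
Lemma germ_angle (G : germ R) t : expR (3 * t) < g_radius G ->
  angle_at (traj_exp (g_traj G)) t.
Proof.
move=> tr; pose y := g_traj G.
pose f x := (tw y x * tv y x - tS y x) ^+ 2 + (tS y x - sin (tpsi y x)) ^+ 2 +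
  (tC y x - cos (tpsi y x)) ^+ 2.
have f0 : f 0 = 0.
  have [[z1 z2 z3] [z4 z5 z6]] := g_zero G.
  by rewrite /f /y z1 z3 z4 z5 z6 sin0 cos0 mulr0 !subrr expr0n/= !addr0.
have fcst u : u <= t -> f (expR (3 * u)) = f (expR (3 * t)).
  move=> ut; apply: (hd0_cst (f := fun u => f (expR (3 * u)))) => // s /andP[us st].
  have [] := @g_flow _ G s; first by rewrite (le_lt_trans _ tr)// ler_expR ler_pM2l.
  rewrite /f -/y /= => Hv Hp Hw HC HS Hpsi.
  by hd_ring.
have fc : {for 0, continuous f}.
  have U0 : [set x : R | `|x| < g_radius G] 0 by rewrite /= normr0 g_radius_gt0.
  have [[c1 c2 c3] [c4 c5 c6]] := g_smooth G 0%N.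
  have {}c1 := Ck_continuous c1 U0; have {}c3 := Ck_continuous c3 U0.
  have {}c4 := Ck_continuous c4 U0; have {}c5 := Ck_continuous c5 U0.
  have {}c6 := Ck_continuous c6 U0.
  have sq (h : R -> R) : {for 0, continuous h} -> {for 0, continuous (fun x => h x ^+ 2)}.
    by move=> hc; apply: (continuousM hc hc).
  apply: continuousD; first apply: continuousD; apply: sq.
  - by apply: continuousB => //; exact: continuousM.
  - by apply: continuousB => //; apply: continuous_comp => //; exact: continuous_sin.
  - by apply: continuousB => //; apply: continuous_comp => //; exact: continuous_cos.
have fge x : 0 <= f x by rewrite /f !addr_ge0 ?sqr_ge0.
have : f (expR (3 * t)) = 0.
  apply/eqP; rewrite eq_le fge andbT leNgt; apply/negP => fpos.
  have : \forall x \near (0 : R), f x < f (expR (3 * t)).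
    by apply: (cvgr_lt _ fc); rewrite f0.
  move=> /nbhs_ballP[e /= e0 He].
  pose x := Num.min (e / 2) (expR (3 * t)).
  have x0 : 0 < x by rewrite lt_min divr_gt0// expR_gt0.
  have xt : x <= expR (3 * t) by rewrite ge_min lexx orbT.
  have xE : x = expR (3 * (ln x / 3)) by rewrite mulrC divfK ?lnK// pnatr_eq0.
  have : f x < f (expR (3 * t)).
    apply: He; rewrite /ball/= sub0r normrN gtr0_norm//.
    have : x <= e / 2 by rewrite ge_min lexx.
    by move=> ?; lra.
  rewrite xE fcst ?ltxx//.
  by rewrite -(ler_pM2l (x := 3))// -ler_expR -xE.
move/eqP; rewrite /f !paddr_eq0 ?addr_ge0 ?sqr_ge0// !sqrf_eq0 !subr_eq0.
by move=> /andP[/andP[/eqP E1 /eqP E2] /eqP E3]; split.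
Qed.

Lemma Ck1_itv_glue n (f g : R -> R) (c m d : R) : c <= 0 -> 0 < m ->
  Ck1 n [set x | c < x < m] f -> Ck1 n [set x | 0 < x < d] g ->
  (forall x, 0 < x < m -> f x = g x) ->
  Ck1 n [set x | c < x < d] (fun x => if x < m then f x else g x).
Proof.
move=> c0 m0 kf kg fg.
have o1 := @open_between R.
have k1 : Ck1 n [set x | c < x < m] (fun x => if x < m then f x else g x).
  by apply: Ck_eq kf => [//|x /= /andP[_ ->]].
have k2 : Ck1 n [set x | 0 < x < d] (fun x => if x < m then f x else g x).
  apply: Ck_eq kg => [//|x /= /andP[x0 xd]]; case: ltP => // xm.
  by rewrite fg// x0.
apply: Ck_sub (CkU k1 k2) => x /= /andP[cx xd].
have [xm|mx] := ltP x m; first by left; rewrite cx.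
by right; rewrite xd (lt_le_trans m0).
Qed.

(* [psi] is the angle in terms of [|x|]; [F] and [G] are [sin psi / |x|] and
   [cos psi] in terms of [|x|^2]. *)
Definition profile (a rho : R) (psi F G : R -> R) : Prop :=
  let U := [set x | - rho < x < 1 + rho] in
  [/\ forall n, [/\ Ck1 n U psi, Ck1 n U F & Ck1 n U G],
      psi 0 = 0, psi 1 = a,
      forall x, 0 <= x -> x ^+ 2 < 1 + rho ->
        sin (psi x) = x * F (x ^+ 2) /\ cos (psi x) = G (x ^+ 2) &
      forall s, 0 < s < 1 + rho -> bitension_eq F G s].

Lemma profile_exists (a : R) : 0 < a ->
  exists psi F G : R -> R, exists2 rho, 0 < rho & profile a rho psi F G.
Proof.
move=> a0; have [K] := germ_exists R.
pose g := g_traj K; pose r := g_radius K; have r0 : 0 < r by exact: g_radius_gt0.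
have [[z1 z2 z3] [z4 z5 z6]] := g_zero K.
(* Near the rest point p = 3, w = 1/3 the strict inequalities persist; p < 4 is stronger than p < v
   + 4 once v > 0. The condition on psi leaves room for the intermediate value theorem. *)
have [t0 [t0r reg0 psi0]] : exists t0, [/\ expR (3 * t0) < r,
    region_at (traj_exp g) t0 & tpsi (traj_exp g) t0 < a].
  have U0 : [set x : R | `|x| < r] 0 by rewrite /= normr0.
  have [[_ c2 c3] [_ _ c6]] := g_smooth K 0%N.
  have {}c2 := Ck_continuous c2 U0; have {}c3 := Ck_continuous c3 U0.
  have {}c6 := Ck_continuous c6 U0.
  have [e e0 vpos] := g_pos K.
  have : \forall x \near (0 : R), [/\ 2 < tp g x, tp g x < 4,
      tw g x < 3 / 5, - (3 / 5) < tw g x & tpsi g x < a].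
    near=> x; split; near: x.
    - by apply: (cvgr_gt _ c2); rewrite z2; lra.
    - by apply: (cvgr_lt _ c2); rewrite z2; lra.
    - by apply: (cvgr_lt _ c3); rewrite z3; lra.
    - by apply: (cvgr_gt _ c3); rewrite z3; lra.
    - by apply: (cvgr_lt _ c6); rewrite z6.
  move=> /nbhs_ballP[d /= d0 Hd].
  pose x := Num.min (Num.min (e / 2) (d / 2)) (r / 2).
  have x0 : 0 < x by rewrite !lt_min !divr_gt0.
  have xe : x <= e / 2 by rewrite /x !ge_min lexx.
  have xd : x <= d / 2 by rewrite /x !ge_min lexx !orbT.
  have xr : x <= r / 2 by rewrite /x !ge_min lexx !orbT.
  have xE : expR (3 * (ln x / 3)) = x by rewrite mulrC divfK ?lnK// pnatr_eq0.
  have [|p1 p2 w1 w2 p3] := Hd x.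
    by rewrite /ball/= sub0r normrN gtr0_norm//; lra.
  have v0 : 0 < tv g x by apply: vpos; rewrite x0/=; lra.
  exists (ln x / 3); rewrite /region_at /= xE; split => //; first by lra.
  split => //; last by lra.
  by rewrite ltr_norml w1 w2.
pose T0 := ln r / 3.
have T0E : expR (3 * T0) = r by rewrite /T0 mulrC divfK ?lnK// pnatr_eq0.
have lt_T0 t : (expR (3 * t) < r) = (t < T0).
  by rewrite -T0E ltr_expR ltr_pM2l.
have fy0 t : t < T0 -> flow_at (traj_exp g) t.
  by rewrite -lt_T0; exact: g_flow.
have ang0 t : t < T0 -> angle_at (traj_exp g) t.
  by rewrite -lt_T0; exact: germ_angle.
have t0T0 : t0 < T0 by rewrite -lt_T0.
have [y [T [t1 [fy yg /andP[t01 t1T] at1]]]] :=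
  flow_continue t0T0 fy0 (ang0 _ t0T0) reg0 a.
have angy t : t < T -> angle_at y t.
  move=> tT.
  have ang_le s : s <= t0 -> angle_at y s.
    move=> st0; have [[e1 e2 e3] [e4 e5 e6]] := yg s st0.
    rewrite /angle_at e1 e3 e4 e5 e6; apply: ang0.
    exact: le_lt_trans t0T0.
  have [tt0|t0t] := leP t t0; first exact: ang_le.
  apply: (@flow_angle _ y t0) => //; [|exact: ltW|exact: ang_le].
  by move=> u /andP[_ ut]; apply: fy; exact: le_lt_trans tT.
have [ts t0ts tsE] : exists2 ts, t0 <= ts <= t1 & tpsi y ts = a.
  have [||c cin cE] := @IVT _ (tpsi y) t0 t1 a t01.
  - apply: continuous_in_subspaceT => t; rewrite inE/= in_itv/= => /andP[_ tt1].
    by have [_ _ _ _ _ H] := fy t (le_lt_trans tt1 t1T); exact: hd_cont H.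
  - have [_ [_ _ e6]] := yg t0 (lexx _).
    by rewrite ge_min le_max e6 (ltW psi0) at1 orbT.
  by exists c => //; move: cin; rewrite in_itv.
have tsT : ts < T by case/andP: t0ts => _ /le_lt_trans; apply.
(* Translating t dilates r: psi now takes the value [a] at t = 0, that is r = 1, and the trajectory
   continues to [T' > 0], past the boundary of the ball. *)
pose z := traj_shift (- ts) y; pose T' := T - ts.
have T'0 : 0 < T' by rewrite subr_gt0.
have fz t : t < T' -> flow_at z t.
  by move=> tT; apply: flow_shift; apply: fy; rewrite /T' in tT; lra.
have angz t : t < T' -> angle_at z t.
  by move=> tT; have := angy (t - - ts); apply; rewrite /T' in tT; lra.
pose E := expR ts; have E0 : 0 < E by exact: expR_gt0.
pose r1 := expR (t0 - ts); have r10 : 0 < r1 by exact: expR_gt0.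
pose b := expR T'; have b1 : 1 < b by rewrite -expR0 ltr_expR.
have Er1 : (E * r1) ^+ 3 < r.
  by rewrite /E /r1 -expRD addrC subrK -expRM_natl.
have zg t : t <= t0 - ts -> [/\ tC z t = tC g (expR (3 * (t + ts))),
    tS z t = tS g (expR (3 * (t + ts))) & tpsi z t = tpsi g (expR (3 * (t + ts)))].
  move=> tt0; have [|_ [e4 e5 e6]] := yg (t + ts); first by lra.
  by rewrite /z /= opprK e4 e5 e6.
have cube (c m x : R) : 0 < c -> - m < x < m -> `|(c * x) ^+ 3| < (c * m) ^+ 3.
  move=> c0; rewrite -ltr_norml => xm; rewrite normrX normrM gtr0_norm//.
  have m0 : 0 < m by exact: le_lt_trans xm.
  by rewrite ltr_pXn2r ?nnegrE ?mulr_ge0 ?(ltW c0) ?(ltW m0)// ltr_pM2l.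
have E_cube (t : R) : expR (3 * (t + ts)) = (E * expR t) ^+ 3.
  by rewrite expRM_natl addrC expRD.
(* After the dilation zeta is [(E * x) ^+ 3]. The formula of the germ crosses [x = 0], the
   logarithmic one reaches beyond 1, and they agree for [0 < x < r1]. In [F], the quotient of zeta
   g_S(zeta^2) by x is rewritten with s = x^2. *)
pose psi x := if x < r1 then tpsi g ((E * x) ^+ 3) else tpsi z (ln x).
pose F s := if s < r1 ^+ 2 then E ^+ 3 * s * g_S K ((E ^+ 2 * s) ^+ 3)
  else tS z (ln s / 2) * expR (- (ln s / 2)).
pose G s := if s < r1 ^+ 2 then 1 + (E ^+ 2 * s) ^+ 3 * g_C K ((E ^+ 2 * s) ^+ 3)
  else tC z (ln s / 2).
have lnr1 (x : R) : 0 < x -> x < r1 -> ln x <= t0 - ts.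
  by move=> x0 xr; rewrite -ler_expR lnK// ltW.
have psiE x : 0 < x -> psi x = tpsi z (ln x).
  move=> x0; rewrite /psi; case: ltP => // xr.
  by have [_ _ ->] := zg _ (lnr1 x x0 xr); rewrite E_cube lnK.
have half (s : R) : 0 < s -> expR (ln s / 2) ^+ 2 = s.
  by move=> s0; rewrite -expRM_natl mulrC divfK ?pnatr_eq0// lnK.
have small (s : R) : 0 < s -> s < r1 ^+ 2 -> ln s / 2 <= t0 - ts /\
    `|(E * expR (ln s / 2)) ^+ 3| < r.
  move=> s0 sr; have xr : expR (ln s / 2) < r1.
    rewrite -(ltr_pXn2r (n := 2)) ?nnegrE ?expR_ge0 ?(ltW r10)//.
    by rewrite half.
  split; first by rewrite -ler_expR ltW.
  apply: lt_trans (Er1); apply: cube => //.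
  by rewrite xr andbT (lt_trans _ (expR_gt0 _))// oppr_lt0.
have FE s : 0 < s -> F s = tS z (ln s / 2) * expR (- (ln s / 2)).
  move=> s0; rewrite /F; case: ltP => // sr.
  have [le_s abs_s] := small s s0 sr.
  have [_ -> _] := zg _ le_s; rewrite E_cube (g_S_even abs_s) expRN.
  have := half s s0; have := expR_gt0 (ln s / 2).
  move: (expR (ln s / 2)) => x x0 <-.
  have -> : (E ^+ 2 * x ^+ 2) ^+ 3 = ((E * x) ^+ 3) ^+ 2 by ring.
  by field; rewrite gt_eqF.
have GE s : 0 < s -> G s = tC z (ln s / 2).
  move=> s0; rewrite /G; case: ltP => // sr.
  have [le_s abs_s] := small s s0 sr.
  have [-> _ _] := zg _ le_s; rewrite E_cube (g_C_even abs_s).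
  have := half s s0; move: (expR (ln s / 2)) => x <-.
  have -> : (E ^+ 2 * x ^+ 2) ^+ 3 = ((E * x) ^+ 3) ^+ 2 by ring.
  by [].
have SF t : tS z t = expR t * F (expR (2 * t)).
  rewrite FE ?expR_gt0// expRK [2 * t]mulrC mulfK ?pnatr_eq0// mulrCA.
  by rewrite -expRD addrN expR0 mulr1.
have CG t : tC z t = G (expR (2 * t)).
  by rewrite GE ?expR_gt0// expRK [2 * t]mulrC mulfK ?pnatr_eq0.
have o1 := @open_between R.
have sm n := (flow_smooth fz n).
have kln n (d : R) : Ck1 n [set x | 0 < x < d] (@ln R).
  by apply: Ck_sub (Ck1_ln R n) => x /= /andP[].
have klin n (c u w : R) : Ck1 n [set x | u < x < w] (fun x => c * x).
  by apply: CkZ => //; exact: Ck1_id.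
have Kpsi n : Ck1 n [set x | - r1 < x < b] psi.
  have [_ [_ _ k6]] := g_smooth K n; have [_ [_ _ s6]] := sm n.
  apply: Ck1_itv_glue => //; first by rewrite oppr_le0 ltW.
  - apply: (Ck_comp (f := tpsi g) (g := fun x => (E * x) ^+ 3) _ _ k6) => //.
      by move=> x xr /=; apply: lt_trans Er1; exact: cube.
    by apply: CkX => //; exact: klin.
  - apply: (Ck_comp (f := tpsi z) (g := @ln R) _ _ s6) => //.
    by move=> x /= /andP[x0 xb]; rewrite -ltr_expR lnK.
  - by move=> x /andP[x0 xr]; rewrite -psiE// /psi xr.
have r12 : 0 < r1 ^+ 2 by rewrite exprn_gt0.
have lnb s : 0 < s -> s < b ^+ 2 -> ln s / 2 < T'.
  move=> s0 sb; rewrite ltr_pdivrMr// -ltr_expR lnK//.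
  by rewrite mulrC expRM_natl.
have cube2 x : - r1 ^+ 2 < x < r1 ^+ 2 -> `|(E ^+ 2 * x) ^+ 3| < r ^+ 2.
  move=> xr; apply: lt_trans (cube (E ^+ 2) (r1 ^+ 2) x _ xr) _; first by rewrite exprn_gt0.
  rewrite -exprMn -exprM mulnC exprM ltr_pXn2r ?nnegrE ?(ltW r0)//.
  by rewrite exprn_ge0// mulr_ge0// ltW.
have khalf n : Ck1 n [set x | 0 < x < b ^+ 2] (fun s => ln s / 2).
  have -> : (fun s : R => ln s / 2) = (fun s => 2^-1 * ln s) by apply/funext => s; rewrite mulrC.
  by apply: CkZ.
have kc n : Ck1 n [set x | - r1 ^+ 2 < x < r1 ^+ 2] (fun x => (E ^+ 2 * x) ^+ 3).
  by apply: CkX => //; exact: klin.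
have KF n : Ck1 n [set x | - r1 ^+ 2 < x < b ^+ 2] F.
  have [k5 _] := g_smooth2 K n; have [_ [_ s5 _]] := sm n.
  apply: Ck1_itv_glue => //; first by rewrite oppr_le0 ltW.
  - apply: (CkM (f := fun x => E ^+ 3 * x) (g := fun x => g_S K ((E ^+ 2 * x) ^+ 3)) (o1 _ _)).
      exact: klin.
    exact: (Ck_comp (f := g_S K) (g := fun x => (E ^+ 2 * x) ^+ 3) _ _ k5).
  - apply: (CkM (f := fun s => tS z (ln s / 2)) (g := fun s => expR (- (ln s / 2)))) => //.
      apply: (Ck_comp (f := tS z) (g := fun s => ln s / 2) _ _ s5) => //.
      by move=> x /= /andP[x0 xb]; exact: lnb.
    apply: (Ck_comp (W := setT) (f := @expR R) (g := fun s => - (ln s / 2))) => //.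
      by apply: Ck1_expR; exact: openT.
    exact: (CkN (f := fun s => ln s / 2)).
  - by move=> x /andP[x0 xr]; rewrite -FE// /F xr.
have KG n : Ck1 n [set x | - r1 ^+ 2 < x < b ^+ 2] G.
  have [_ k4] := g_smooth2 K n; have [_ [s4 _ _]] := sm n.
  apply: Ck1_itv_glue => //; first by rewrite oppr_le0 ltW.
  - apply: (CkD (f := cst 1)
      (g := fun x => (E ^+ 2 * x) ^+ 3 * g_C K ((E ^+ 2 * x) ^+ 3))) => //.
      exact: Ck_cst.
    apply: (CkM (f := fun x => (E ^+ 2 * x) ^+ 3)
      (g := fun x => g_C K ((E ^+ 2 * x) ^+ 3))) => //.
    exact: (Ck_comp (f := g_C K) (g := fun x => (E ^+ 2 * x) ^+ 3) _ _ k4).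
  - apply: (Ck_comp (f := tC z) (g := fun s => ln s / 2) _ _ s4) => //.
    by move=> x /= /andP[x0 xb]; exact: lnb.
  - by move=> x /andP[x0 xr]; rewrite -GE// /G xr.
(* [r1] and [r1 ^+ 2] limit the left ends of the domains of [psi] and of [F], [G]; [b - 1] limits
   the right ends, since [b <= b ^+ 2]. *)
pose rho := Num.min (Num.min r1 (r1 ^+ 2)) (b - 1).
have rho0 : 0 < rho by rewrite !lt_min r10 r12 subr_gt0.
have [rho1 rho2 rho3] : [/\ rho <= r1, rho <= r1 ^+ 2 & rho <= b - 1].
  by rewrite /rho !ge_min !lexx !orbT.
have bb : b <= b ^+ 2 by rewrite expr2 ler_peMl// ltW// (lt_trans ltr01).
exists psi, F, G, rho; first exact: rho0.
split.
- move=> n; split.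
  + by apply: Ck_sub (Kpsi n) => x /= /andP[x1 x2]; apply/andP; split; lra.
  + by apply: Ck_sub (KF n) => x /= /andP[x1 x2]; apply/andP; split; lra.
  + by apply: Ck_sub (KG n) => x /= /andP[x1 x2]; apply/andP; split; lra.
- by rewrite /psi r10 mulr0 expr0n/= z6.
- by rewrite psiE// ln1 /z /= opprK add0r.
- move=> x; rewrite le_eqVlt => /orP[/eqP <- _|x0 xrho].
    rewrite /psi r10 expr0n/= mulr0 expr0n/= z6 sin0 cos0 mul0r /G r12.
    by rewrite mulr0 expr0n/= mul0r addr0.
  have xT : ln x < T'.
    have : x ^+ 2 < b ^+ 2 by lra.
    by move=> /(lnb _ (exprn_gt0 2 x0)); rewrite lnXn// -[ln x *+ 2]mulr_natr mulfK ?pnatr_eq0.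
  have [_ E2 E3] := angz _ xT.
  by rewrite psiE// -E2 -E3 SF CG expRM_natl lnK.
move=> s /andP[s0 srho].
have sb : s < b ^+ 2 by lra.
have sE : s = expR (2 * (ln s / 2)) by rewrite expRM_natl half.
apply: (flow_bitension (U := [set x | - r1 ^+ 2 < x < b ^+ 2]) fz angz _ (KF 4%N) (KG 4%N)
  (fun t _ => SF t) (fun t _ => CG t) (lnb s s0 sb) sE) => t tT /=.
rewrite expRM_natl (lt_trans _ (exprn_gt0 2 (expR_gt0 t))) ?oppr_lt0//=.
by rewrite ltr_pXn2r ?nnegrE ?expR_ge0// ltr_expR.
Unshelve. all: by end_near.
Qed.

Lemma profile0 : profile 0 1 (fun=> 0) (fun=> 0) (fun=> 1).
Proof.
split=> [n|||x _ _|s _].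
- by split; exact: Ck_cst.
- by [].
- by [].
- by rewrite sin0 cos0 mulr0.
have D0 k : derive1n k (fun=> 0 : R) = (fun=> 0).
  elim: k => [//|k IH]; rewrite derive1nS IH.
  by apply/funext => z; rewrite derive1_cst.
by rewrite /bitension_eq !D0 !mulr0 mul0r !addr0 mulr0.
Qed.

(** For fixed [G] the equation is linear in [F]. The derivatives of [- F] are computed only on the
    interval where [F] is known to be smooth. *)
Lemma profileN a rho psi F G : 0 < rho -> profile a rho psi F G ->
  profile (- a) rho (fun x => - psi x) (fun s => - F s) G.
Proof.
move=> rho0 [sm psi0 psi1 FG te].
have oU := @open_between R (- rho) (1 + rho).
have kF n : Ck1 n [set x : R | - rho < x < 1 + rho] F by have [] := sm n.
split.
- move=> n; have [k1 k2 k3] := sm n; split => //.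
    exact: (CkN (f := psi)).
  exact: (CkN (f := F)).
- by rewrite psi0 oppr0.
- by rewrite psi1.
- by move=> x x0 xr; have [E1 E2] := FG x x0 xr; rewrite sinN cosN E1 E2 mulrN.
have DN k s : - rho < s < 1 + rho -> derive1n k (fun s => - F s) s = - derive1n k F s.
  elim: k s => [//|k IH] s sU.
  have H := hdN (Ck1_hd (kF k.+1) (ltnSn k) sU).
  have [_ E] := hd_open oU sU (fun z zU => esym (IH z zU)) H.
  by rewrite derive1nS derive1E.
move=> s sr; have sU : - rho < s < 1 + rho.
  by case/andP: sr => s0 s1; rewrite s1 andbT; lra.
have := te s sr; rewrite /bitension_eq !(DN _ s sU).
move: (derive1n 2 F s) (derive1n 3 F s) (derive1n 4 F s) => F2 F3 F4.
move: (derive1n 2 G s) (derive1n 3 G s) (derive1n 4 G s) => G2 G3 G4 E.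
by rewrite mulNr -E; ring.
Qed.

End ProfileExists.

(** * The equivariant map *)

Section EquivariantMap.
Variable R : realType.
Local Notation Ck1 := (Ck (@dir1 R)).
Local Notation V := 'rV[R]_4.

Definition dirs (i : 'I_4) : V := delta_mx 0 i.
Local Notation Ck4 := (Ck dirs).

Definition normsq (x : V) : R := dotv x x.

Lemma is_derive_coord (i k : 'I_4) (x : V) :
  is_derive x (dirs i) (fun z : V => z 0 k) (i == k)%:R.
Proof.
have H : derivable (id : V -> V) x (dirs i) by exact: derivable_id.
split; first exact: (derivable_mxP _ _ _).1 H 0 k.
have := derive_mx H; rewrite derive_id => /matrixP/(_ 0 k).
by rewrite !mxE eqxx /= eq_sym.
Qed.

Lemma Ck4_coord n (U : set V) (k : 'I_4) : Ck4 n U (fun x => x 0 k).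
Proof.
have c x : U x -> {for x, continuous (fun z : V => z 0 k)} by move=> _; exact: coord_continuous.
case: n => [|n]; split => // i; split => [x _|]; first by have [] := is_derive_coord i k x.
have -> : 'D_(dirs i) (fun z : V => z 0 k) = cst (i == k)%:R.
  by apply/funext => x; have [_ ->] := is_derive_coord i k x.
exact: Ck_cst.
Qed.

Lemma normsqE x : normsq x = \sum_k x 0 k ^+ 2.
Proof. by apply: eq_bigr => k _; rewrite expr2. Qed.

Lemma normsq_ge0 x : 0 <= normsq x.
Proof. by rewrite normsqE sumr_ge0// => k _; rewrite sqr_ge0. Qed.

Lemma enorm_sq x : enorm x ^+ 2 = normsq x.
Proof. by rewrite /enorm sqr_sqrtr// normsq_ge0. Qed.

Lemma normsq_eq0 x : normsq x = 0 -> x = 0.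
Proof.
rewrite normsqE => /eqP; rewrite psumr_eq0 => [/allP H|k _]; last exact: sqr_ge0.
apply/rowP => k; rewrite mxE; apply/eqP.
by have := H k (mem_index_enum k); rewrite sqrf_eq0.
Qed.

Lemma Ck4_normsq n (U : set V) : open U -> Ck4 n U normsq.
Proof.
move=> oU; have -> : normsq = (fun x => \sum_k x 0 k ^+ 2) by apply/funext => x; rewrite normsqE.
by apply: Ck_sum => // k; apply: CkX => //; exact: Ck4_coord.
Qed.

Lemma is_derive_normsq (i : 'I_4) (x : V) : is_derive x (dirs i) normsq (2 * x 0 i).
Proof.
have -> : normsq = \sum_k (fun z : V => z 0 k) ^+ 2.
  by apply/funext => z; rewrite normsqE fct_sumE; apply: eq_bigr => k _; rewrite fctE.
have H k := is_deriveX 2 (is_derive_coord i k x).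
apply: is_derive_eq (is_derive_sum H) _.
rewrite (bigD1 i)//= eqxx big1 => [|k ki]; last by rewrite eq_sym (negbTE ki) scaler0.
by rewrite addr0 expr1 /GRing.scale/= mulr1.
Qed.

Definition ball_nbhs (c : R) : set V := [set x | normsq x < c].

Lemma open_ball_nbhs c : open (ball_nbhs c).
Proof.
rewrite /ball_nbhs (_ : mkset _ = normsq @^-1` [set s | s < c]); last by [].
apply: open_comp => [x _|]; last exact: open_lt.
exact: (Ck_continuous (Ck4_normsq 0 openT) (I : setT x)).
Qed.

(** * Derivatives and Laplacians of equivariant maps *)

Section Radial.
Variables (rho : R) (rho0 : 0 < rho).
Let W : set R := [set s | - rho < s < 1 + rho].
Let U := ball_nbhs (1 + rho).

Lemma open_W : open W.
Proof. exact: open_between. Qed.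

Lemma W_normsq x : U x -> W (normsq x).
Proof.
by rewrite /U /W /ball_nbhs /= => ->; rewrite andbT (lt_le_trans _ (normsq_ge0 x))// oppr_lt0.
Qed.

Lemma W_itv s : 0 <= s <= 1 -> W s.
Proof.
by have h := rho0; rewrite /W /= => /andP[s0 s1]; apply/andP; split; lra.
Qed.

Lemma closed_ball_U x : @closed_ball1 R 4 x -> U x.
Proof.
rewrite /closed_ball1 /U /ball_nbhs/= -enorm_sq => x1.
have : enorm x ^+ 2 <= 1 by rewrite expr_le1// sqrtr_ge0.
by move=> H; apply: le_lt_trans H _; rewrite ltrDl.
Qed.

Lemma open_ball_closed x : @open_ball1 R 4 x -> @closed_ball1 R 4 x.
Proof. exact: ltW. Qed.

Lemma Ck1_derive1n (f : R -> R) k : (forall n, Ck1 n W f) -> forall n, Ck1 n W (derive1n k f).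
Proof.
elim: k f => [|k IH] f kf n; first exact: kf.
rewrite derive1Sn; apply: IH => m.
exact: Ck1_derive1 (kf m.+1).
Qed.

(** Coordinate j of the map (F(|x|^2) x, G(|x|^2)). Unlike |x|, the square is smooth at the origin,
    and [W] extends below 0 so that [F] and [G] are smooth across that value. *)
Definition eqv (F G : R -> R) (j : 'I_(4 + 1)) (x : V) : R :=
  match fintype.split j with inl k => x 0 k * F (normsq x) | inr _ => G (normsq x) end.

Lemma eqv_l F G k x : eqv F G (lshift 1 k) x = x 0 k * F (normsq x).
Proof. by rewrite /eqv (unsplitK (inl k)). Qed.

Lemma eqv_r F G k x : eqv F G (rshift 4 k) x = G (normsq x).
Proof. by rewrite /eqv (unsplitK (inr k)). Qed.

Lemma Ck4_eqv (F G : R -> R) n j : Ck1 n W F -> Ck1 n W G -> Ck4 n U (eqv F G j).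
Proof.
move=> kF kG; have oU : open U by exact: open_ball_nbhs.
have H (f : R -> R) : Ck1 n W f -> Ck4 n U (fun x => f (normsq x)).
  move=> kf; apply: (Ck_comp (f := f) (g := normsq) oU W_normsq kf).
  exact: Ck4_normsq.
case: (split_ordP j) => k ->.
  have -> : eqv F G (lshift 1 k) = (fun x : V => x 0 k) * (fun x => F (normsq x)).
    by apply/funext => x; rewrite eqv_l.
  by apply: CkM => //; [exact: Ck4_coord|exact: H].
have -> : eqv F G (rshift 4 k) = (fun x => G (normsq x)).
  by apply/funext => x; rewrite eqv_r.
exact: H.
Qed.

Lemma derive_on_eq (f g : V -> R) (i : 'I_4) (x : V) : U x ->
  (forall z, U z -> f z = g z) -> 'D_(dirs i) f x = 'D_(dirs i) g x.
Proof.
move=> Ux fg; apply: near_eq_derive; apply: near_eq_on fg x Ux.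
exact: open_ball_nbhs.
Qed.

Lemma derive_radial (H : R -> R) (i : 'I_4) x : Ck1 1 W H -> U x ->
  is_derive x (dirs i) (fun z => H (normsq z)) (derive1n 1 H (normsq x) * (2 * x 0 i)).
Proof.
move=> kH Ux.
have h : has_deriv H (normsq x) (derive1n 1 H (normsq x)).
  exact: (Ck1_hd (k := 0) kH isT (W_normsq Ux)).
exact: (is_derive_along (g := normsq) h (is_derive_normsq i x)).
Qed.

Lemma is_derive_mul (f g : V -> R) (x v : V) (a b : R) : is_derive x v f a -> is_derive x v g b ->
  is_derive x v (fun z => f z * g z) (f x * b + g x * a).
Proof. exact: is_deriveM. Qed.

Lemma is_derive_add (f g : V -> R) (x v : V) (a b : R) : is_derive x v f a -> is_derive x v g b ->
  is_derive x v (fun z => f z + g z) (a + b).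
Proof. exact: is_deriveD. Qed.

Lemma derive2_radial (H : R -> R) (i : 'I_4) x : Ck1 2 W H -> U x ->
  'D_(dirs i) ('D_(dirs i) (fun z => H (normsq z))) x =
  2 * derive1n 1 H (normsq x) + 4 * x 0 i ^+ 2 * derive1n 2 H (normsq x).
Proof.
move=> kH Ux; have kH1 : Ck1 1 W (derive1n 1 H) by exact: Ck1_derive1 kH.
rewrite (derive_on_eq (g := fun z : V => derive1n 1 H (normsq z) * (2 * z 0 i)) i Ux) => [|z Uz].
  have H1 := derive_radial i kH1 Ux.
  have H2 := is_derive_mul (is_derive_cst (2 : R) x (dirs i)) (is_derive_coord i i x).
  have [_ ->] := is_derive_mul H1 H2.
  by rewrite eqxx (_ : derive1n 1 (derive1n 1 H) = derive1n 2 H) //=; ring.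
by have [_ ->] := derive_radial i (CkS kH) Uz.
Qed.

Lemma derive2_equivariant (H : R -> R) (i k : 'I_4) x : Ck1 2 W H -> U x ->
  'D_(dirs i) ('D_(dirs i) (fun z : V => z 0 k * H (normsq z))) x =
  4 * (i == k)%:R * x 0 i * derive1n 1 H (normsq x) +
  x 0 k * (2 * derive1n 1 H (normsq x) + 4 * x 0 i ^+ 2 * derive1n 2 H (normsq x)).
Proof.
move=> kH Ux; have kH1 : Ck1 1 W (derive1n 1 H) by exact: Ck1_derive1 kH.
rewrite (derive_on_eq (g := fun z : V => z 0 k * (derive1n 1 H (normsq z) * (2 * z 0 i)) +
    H (normsq z) * (i == k)%:R) i Ux) => [|z Uz].
  have H0 := derive_radial i (CkS kH) Ux; have H1 := derive_radial i kH1 Ux.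
  have H2 := is_derive_mul (is_derive_cst (2 : R) x (dirs i)) (is_derive_coord i i x).
  have [_ ->] := is_derive_add
    (is_derive_mul (is_derive_coord i k x) (is_derive_mul H1 H2))
    (is_derive_mul H0 (is_derive_cst ((i == k)%:R : R) x (dirs i))).
  by rewrite eqxx (_ : derive1n 1 (derive1n 1 H) = derive1n 2 H) //=; ring.
by have [_ ->] := is_derive_mul (is_derive_coord i k z) (derive_radial i (CkS kH) Uz).
Qed.

(* [4 s f'' + c f'] is the Laplacian of [f(|x|^2)] for [c = 8], and its product
   with [x] is the Laplacian of [f(|x|^2) x] for [c = 12]. *)
Definition lap (c : R) (f : R -> R) (s : R) : R :=
  c * derive1n 1 f s + 4 * s * derive1n 2 f s.

Lemma lapE c f s : lap c f s = c * derive1n 1 f s + 4 * s * derive1n 2 f s.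
Proof. by []. Qed.

(** The four directions contribute 8 f' + 4 s f''. For f(|x|^2) x_k the cross term with the gradient
    of x_k adds 4 f', whence 12. *)
Lemma laplacian_eqv (F G : R -> R) x j : Ck1 2 W F -> Ck1 2 W G -> U x ->
  \sum_(i < 4) 'D_(dirs i) ('D_(dirs i) (eqv F G j)) x = eqv (lap 12 F) (lap 8 G) j x.
Proof.
move=> kF kG Ux; case: (split_ordP j) => k ->.
  have -> : eqv F G (lshift 1 k) = (fun x : V => x 0 k * F (normsq x)).
    by apply/funext => z; rewrite eqv_l.
  rewrite eqv_l; under eq_bigr do rewrite derive2_equivariant//.
  rewrite big_split/= (bigD1 k)//= eqxx big1 => [|i ik]; last by rewrite (negbTE ik) mulr0 !mul0r.
  rewrite -mulr_sumr big_split/= sumr_const card_ord -mulr_suml -mulr_sumr -normsqE.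
  by rewrite /lap /=; ring.
have -> : eqv F G (rshift 4 k) = (fun x => G (normsq x)).
  by apply/funext => z; rewrite eqv_r.
rewrite eqv_r; under eq_bigr do rewrite derive2_radial//.
rewrite big_split/= sumr_const card_ord -mulr_suml -mulr_sumr -normsqE.
by rewrite /lap /=; ring.
Qed.

(** * Passage from coordinates to vector-valued maps *)

Section VectorValued.
Variable m : nat.
Implicit Types f : V -> 'rV[R]_m.

Definition CkV n f := forall j, Ck4 n U (fun x => f x 0 j).

Lemma CkV_continuous f x : CkV 0 f -> U x -> {for x, continuous f}.
Proof.
move=> kf Ux; have FF : Filter (nbhs x) by exact: nbhs_filter.
suff : f z @[z --> x] --> f x by [].
apply/cvgrPdist_le => e e0.
near=> z.
rewrite /Num.Def.normr/= mx_normrE (bigmax_le _ (ltW e0))//= => i _.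
rewrite !mxE/=.
move: i; near: z; apply: filter_forall => /= -[i j]; rewrite (ord1 i).
exact: ((cvgrPdist_le _ _).1 (Ck_continuous (kf j) Ux)).
Unshelve. all: by end_near. Qed.

Lemma CkV_derivable n f (i : 'I_4) x : CkV n.+1 f -> U x -> derivable f x (dirs i).
Proof.
move=> kf Ux; apply/derivable_mxP => i' j; rewrite (ord1 i').
by have [_ /(_ i) [H _]] := kf j; exact: H.
Qed.

Lemma partial_coord n f (i : 'I_4) x j : CkV n.+1 f -> U x ->
  partial i f x 0 j = 'D_(dirs i) (fun z => f z 0 j) x.
Proof. by move=> kf Ux; rewrite /partial derive_mx ?mxE//; exact: CkV_derivable kf Ux. Qed.

Lemma CkV_partial n f (i : 'I_4) : CkV n.+1 f -> CkV n (partial i f).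
Proof.
move=> kf j; have [_ /(_ i) [_ H]] := kf j.
apply: Ck_eq H; first exact: open_ball_nbhs.
by move=> x Ux; rewrite (partial_coord _ _ kf).
Qed.

Lemma CkV_partials (s : seq 'I_4) f : (forall n, CkV n f) -> forall n, CkV n (partials s f).
Proof.
move=> kf; elim: s => [|i s IH] n; first exact: kf.
exact: CkV_partial.
Qed.

Lemma CkV_within f : CkV 0 f -> {within @closed_ball1 R 4, continuous f}.
Proof.
move=> kf; apply: continuous_in_subspaceT => x; rewrite inE => /closed_ball_U Ux.
exact: CkV_continuous.
Qed.

(** [U] is an open neighbourhood of the closed ball, so the partial derivatives are their own
    continuous extensions. *)
Lemma CkV_smooth f : (forall n, CkV n f) -> smooth_closed_ball f.
Proof.
move=> kf; split; first exact: CkV_within.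
move=> s; have ks := CkV_partials s kf; split.
  move=> x /open_ball_closed/closed_ball_U Ux i; exact: CkV_derivable (ks 1%N) Ux.
by exists (partials s f); split => //; exact: CkV_within.
Qed.

End VectorValued.

Lemma laplacian_equivariant (f : V -> 'rV[R]_5) (F G : R -> R) :
  (forall x, U x -> forall j, f x 0 j = eqv F G j x) -> Ck1 2 W F -> Ck1 2 W G ->
  forall x, U x -> forall j, laplacian f x 0 j = eqv (lap 12 F) (lap 8 G) j x.
Proof.
move=> fE kF kG x Ux j; have oU : open U by exact: open_ball_nbhs.
have kf : CkV 2 f.
  move=> k; apply: (Ck_eq (f := eqv F G k)) => //; last exact: Ck4_eqv.
  by move=> z Uz; rewrite fE.
rewrite /laplacian summxE -(laplacian_eqv _ kF kG Ux); apply: eq_bigr => i _.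
rewrite (partial_coord _ _ (CkV_partial i kf) Ux); apply: derive_on_eq => // z Uz.
rewrite (partial_coord _ _ kf Uz); apply: derive_on_eq => // z' Uz'.
exact: fE.
Qed.

Lemma lap_smooth c (f : R -> R) : (forall n, Ck1 n W f) -> forall n, Ck1 n W (lap c f).
Proof.
move=> kf n; have H k := Ck1_derive1n k kf n.
have oW := open_W.
apply: (CkD (f := fun s => c * derive1n 1 f s) (g := fun s => 4 * s * derive1n 2 f s)) => //.
  by apply: CkZ => //; exact: (H 1%N).
apply: (@CkM _ _ _ _ n W (fun s => 4 * s) (derive1n 2 f) oW); last exact: (H 2%N).
by apply: CkZ => //; exact: Ck1_id.
Qed.

Lemma lap_derive (c : R) (F : R -> R) (s : R) : (forall n, Ck1 n W F) -> W s ->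
  derive1n 1 (lap c F) s = (c + 4) * derive1n 2 F s + 4 * s * derive1n 3 F s /\
  derive1n 2 (lap c F) s = (c + 8) * derive1n 3 F s + 4 * s * derive1n 4 F s.
Proof.
move=> kF Ws; pose L := lap c F; rewrite -/L.
have d k z (Wz : W z) : has_deriv (derive1n k F) z (derive1n k.+1 F z).
  exact: Ck1_hd (kF k.+1) (ltnSn k) Wz.
have d1 z : W z -> has_deriv L z ((c + 4) * derive1n 2 F z + 4 * z * derive1n 3 F z).
  move=> Wz; have h1 := d 1%N z Wz; have h2 := d 2%N z Wz; have hi := hd_id z.
  have := hdD (hdM (hd_cst c z) h1) (hdM (hdM (hd_cst 4 z) hi) h2).
  move=> H; apply: (hd_eq H).
  by move: (derive1n 1 F z) (derive1n 2 F z) (derive1n 3 F z) => a1 a2 a3; ring.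
have e1 z (Wz : W z) : derive1n 1 L z = (c + 4) * derive1n 2 F z + 4 * z * derive1n 3 F z.
  by have [_ H] := d1 z Wz; rewrite derive1n1 derive1E.
split; first exact: e1.
have h2 := d 2%N s Ws; have h3 := d 3%N s Ws; have hi := hd_id s.
have H := hdD (hdM (hd_cst (c + 4) s) h2) (hdM (hdM (hd_cst 4 s) hi) h3).
have [_] : has_deriv (derive1n 1 L) s ((c + 8) * derive1n 3 F s + 4 * s * derive1n 4 F s).
  apply: (hd_open (f := fun z => (c + 4) * derive1n 2 F z + 4 * z * derive1n 3 F z) open_W Ws).
    by move=> z Wz; rewrite e1.
  apply: (hd_eq H).
  by move: (derive1n 2 F s) (derive1n 3 F s) (derive1n 4 F s) => a2 a3 a4; ring.
by rewrite -derive1E; apply.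
Qed.

Lemma Upsilon_eqv (psi F G : R -> R) : psi 0 = 0 ->
  (forall x, 0 <= x -> x ^+ 2 < 1 + rho ->
    sin (psi x) = x * F (x ^+ 2) /\ cos (psi x) = G (x ^+ 2)) ->
  forall x, U x -> forall j, Upsilon psi x 0 j = eqv F G j x.
Proof.
move=> psi0 HFG x Ux j.
have [|E1 E2] := HFG (enorm x) (sqrtr_ge0 _); first by rewrite enorm_sq.
rewrite /Upsilon; have [x0|x0] := eqVneq x 0.
  have n0 : normsq x = 0 by rewrite x0 normsqE big1// => k _; rewrite mxE expr0n.
  have e0 : enorm x = 0 by apply/eqP; rewrite -sqrf_eq0 enorm_sq n0.
  rewrite mxE eqxx/=; case: (@split_ordP 4 1 j) => k ->.
    rewrite eqv_l x0 mxE mul0r; apply/eqP; rewrite pnatr_eq0 eqb0.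
    by rewrite -val_eqE/= neq_ltn ltn_ord.
  have G0 : G 0 = 1 by move: E2; rewrite e0 expr0n/= psi0 cos0.
  by rewrite eqv_r n0 G0 -val_eqE/= (ord1 k).
have r0 : enorm x != 0.
  by apply: contra x0 => /eqP e0; apply/eqP/normsq_eq0; rewrite -enorm_sq e0 expr0n.
case: (@split_ordP 4 1 j) => k ->.
  rewrite eqv_l (row_mxEl _ _ 0 k) !mxE E1 enorm_sq.
  by rewrite mulrAC mulrA mulrAC mulfV// mul1r mulrC.
by rewrite eqv_r mxE (unsplitK (inr k)) mxE E2 enorm_sq.
Qed.

(** The bilaplacian of (F x, G) is (X x, Y) for radial X and Y. The equation G X = F Y makes it
    parallel to the map itself, hence normal to the sphere. *)
Lemma equivariant_biharmonic (f : V -> 'rV[R]_5) (F G : R -> R) :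
  (forall n, Ck1 n W F) -> (forall n, Ck1 n W G) ->
  (forall x, U x -> forall j, f x 0 j = eqv F G j x) ->
  (forall x, U x -> normsq x * F (normsq x) ^+ 2 + G (normsq x) ^+ 2 = 1) ->
  (forall s, 0 < s < 1 + rho -> bitension_eq F G s) ->
  biharmonic_to_sphere f.
Proof.
move=> kF kG fE circ tension x /open_ball_closed/closed_ball_U Ux v.
have Lf := laplacian_equivariant fE (kF 2%N) (kG 2%N).
have LLf := laplacian_equivariant Lf (lap_smooth 12 kF 2%N) (lap_smooth 8 kG 2%N).
pose A := \sum_(k < 4) x 0 k * v 0 (lshift 1 k).
pose B := v 0 (rshift 4 (ord0 : 'I_1)).
have A0 : normsq x = 0 -> A = 0.
  by move=> /normsq_eq0 x0; rewrite /A big1// => k _; rewrite x0 mxE mul0r.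
have dot (h : 'rV[R]_5) F' G' : (forall j, h 0 j = eqv F' G' j x) ->
    \sum_(j < 5) h 0 j * v 0 j = F' (normsq x) * A + G' (normsq x) * B.
  move=> hE; rewrite (@big_split_ord _ _ _ 4 1)/= big_ord1 hE eqv_r; congr (_ + _).
  by rewrite mulr_sumr; apply: eq_bigr => k _; rewrite hE eqv_l; ring.
rewrite /tangent_sphere/= /dotv; under eq_bigr do rewrite mulrC.
rewrite (dot _ _ _ (fE x Ux)) (dot _ _ _ (LLf x Ux)).
have Ws : W (normsq x) by exact: W_normsq.
have XE : lap 12 (lap 12 F) (normsq x) = 16 * normsq x ^+ 2 * derive1n 4 F (normsq x) +
    128 * normsq x * derive1n 3 F (normsq x) + 192 * derive1n 2 F (normsq x).
  have [f1 f2] := lap_derive 12 kF Ws; rewrite (lapE _ (lap 12 F)) f1 f2.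
  by move: (derive1n 2 F _) (derive1n 3 F _) (derive1n 4 F _) => F2 F3 F4; ring.
have YE : lap 8 (lap 8 G) (normsq x) = 16 * normsq x ^+ 2 * derive1n 4 G (normsq x) +
    96 * normsq x * derive1n 3 G (normsq x) + 96 * derive1n 2 G (normsq x).
  have [f1 f2] := lap_derive 8 kG Ws; rewrite (lapE _ (lap 8 G)) f1 f2.
  by move: (derive1n 2 G _) (derive1n 3 G _) (derive1n 4 G _) => G2 G3 G4; ring.
have T : 0 < normsq x -> G (normsq x) * lap 12 (lap 12 F) (normsq x) =
    F (normsq x) * lap 8 (lap 8 G) (normsq x).
  by move=> s0; rewrite XE YE; apply: (tension (normsq x)); rewrite s0; case/andP: Ws.
have circ' := circ x Ux.
have s_ge0 := normsq_ge0 x.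
move: (lap 12 (lap 12 F) _) (lap 8 (lap 8 G) _) T => X Y T.
clear dot Lf LLf XE YE; clearbody A B.
move: A0 circ' s_ge0 T; move: (normsq x) (F _) (G _) => s a b A0 circ' s_ge0 T E.
(* The equation is given for [s > 0] only. At the origin the map is (0, b) with b^2 = 1, so tangency
   forces [B = 0], and [A] vanishes with x. *)
have [s0|s0] := eqVneq s 0.
  move: circ' E; rewrite s0 (A0 s0) mul0r !mulr0 !add0r => b1 /eqP.
  rewrite mulf_eq0 => /orP[/eqP b0|/eqP ->]; last by rewrite mulr0.
  by move: b1; rewrite b0 expr0n/= => /eqP; rewrite eq_sym oner_eq0.
have {}T : b * X = a * Y by apply: T; rewrite lt_neqAle eq_sym s0.
(* From [b * X = a * Y] and tangency, both [a] and [b] annihilate the inner product. The circle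
   relation then recovers it without dividing by a coefficient that may vanish. *)
have Z1 : a * (X * A + Y * B) = 0.
  have -> : a * (X * A + Y * B) = X * (a * A) + a * Y * B by ring.
  rewrite -T; have -> : a * A = - (b * B) by lra.
  by ring.
have Z2 : b * (X * A + Y * B) = 0.
  have -> : b * (X * A + Y * B) = b * X * A + Y * (b * B) by ring.
  rewrite T; have -> : b * B = - (a * A) by lra.
  by ring.
rewrite -[LHS]mul1r -circ'.
have -> : (s * a ^+ 2 + b ^+ 2) * (X * A + Y * B) =
  s * a * (a * (X * A + Y * B)) + b * (b * (X * A + Y * B)) by ring.
by rewrite Z1 Z2 !mulr0 addr0.
Qed.

End Radial.
End EquivariantMap.

(** * Smoothness of psi on the interval and the three signs of a *)

Lemma smooth_profile (R : realType) (rho : R) (psi : R -> R) : 0 < rho ->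
  (forall n, Ck (@dir1 R) n [set x | - rho < x < 1 + rho] psi) -> smooth_unit_interval psi.
Proof.
move=> rho0 kpsi; have kd k := Ck1_derive1n k kpsi.
have within k : {within `[0, 1], continuous (derive1n k psi)}.
  apply: continuous_in_subspaceT => x; rewrite inE/= in_itv/= => x01.
  exact: Ck_continuous (kd k 0%N) (W_itv rho0 x01).
split; first exact: (within 0%N).
move=> k; split; last by exists (derive1n k psi); split => //; exact: within.
move=> t /andP[t0 t1]; have t01 : 0 <= t <= 1 by rewrite !ltW.
by have [] := Ck1_hd (kpsi k.+1) (ltnSn k) (W_itv rho0 t01).
Qed.

Theorem theorem1p7 (R : realType) (a : R) :
  exists psi : R -> R,
    smooth_unit_interval psi /\ psi 0 = 0 /\ psi 1 = a /\
    (forall x : 'rV[R]_4, closed_ball1 x -> sphere1 (Upsilon psi x)) /\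
    smooth_closed_ball (Upsilon psi) /\
    biharmonic_to_sphere (Upsilon psi).
Proof.
have [psi [F [G [rho rho0 [sm psi0 psi1 FG te]]]]] : exists psi F G : R -> R,
    exists2 rho, 0 < rho & profile a rho psi F G.
  have [a0|a0|->] := ltgtP a 0.
  - have [|psi [F [G [rho rho0 H]]]] := @profile_exists R (- a); first by rewrite oppr_gt0.
    exists (fun x => - psi x), (fun s => - F s), G; exists rho; first exact: rho0.
    by rewrite -[a]opprK; exact: profileN rho0 H.
  - exact: profile_exists.
  - by exists (fun=> 0), (fun=> 0), (fun=> 1); exists 1; [exact: ltr01|exact: profile0].
have kF n : Ck (@dir1 R) n [set x | - rho < x < 1 + rho] F by have [] := sm n.
have kG n : Ck (@dir1 R) n [set x | - rho < x < 1 + rho] G by have [] := sm n.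
have uE := Upsilon_eqv psi0 FG.
have circ x : ball_nbhs (1 + rho) x -> normsq x * F (normsq x) ^+ 2 + G (normsq x) ^+ 2 = 1.
  move=> Ux; have [|E1 E2] := FG (enorm x) (sqrtr_ge0 _); first by rewrite enorm_sq.
  by rewrite -[RHS](cos2Dsin2 (psi (enorm x))) E1 E2 exprMn !enorm_sq addrC.
exists psi; split; first by apply: (smooth_profile rho0) => n; have [] := sm n.
split; first exact: psi0.
split; first exact: psi1.
split.
  move=> x /(closed_ball_U rho0) Ux; rewrite /sphere1/= /enorm /dotv.
  rewrite (@big_split_ord _ _ _ 4 1)/= big_ord1 uE// eqv_r.
  under eq_bigr => k _ do rewrite uE// eqv_l.
  rewrite -[RHS]sqrtr1 -(circ x Ux) normsqE mulr_suml expr2; congr (Num.sqrt (_ + _)).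
  by apply: eq_bigr => k _; ring.
split; last exact: (equivariant_biharmonic rho0 kF kG uE circ te).
apply: (CkV_smooth rho0) => n j.
apply: (Ck_eq (f := eqv F G j)); first exact: open_ball_nbhs.
  by move=> x Ux; rewrite uE.
exact: (Ck4_eqv rho0).
Qed.
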